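(* Assume that the kernels satisfy $0\le k^j(x,x')\le K^j$ for all $x,x'\in\mathbb X^j$, $j\in[d]$, are translation invariant, and have non-empty level sets on $\mathbb X^j$. Let $\mathcal P_{\mathbb X^1\times\dots\times\mathbb X^d}$ be a class of distributions on $\mathbb X^1\times\dots\times\mathbb X^d$ such that if $P_{X^1,\dots,X^d}\in\mathcal P_{\mathbb X^1\times\dots\times\mathbb X^d}$, then $wP_{X^1,\dots,X^d}+(1-w)P_{X^1}\cdots P_{X^d}\in\mathcal P_{\mathbb X^1\times\dots\times\mathbb X^d}$ for all $w\in[0,1]$, and such that there exists $P_{X^1,\dots,X^d}\in\mathcal P_{\mathbb X^1\times\dots\times\mathbb X^d}$ with $\mathrm{dHSIC}_{\mathbf k}(P_{X^1,\dots,X^d})=\varrho_0$ for some fixed $\varrho_0>0$. Let $\alpha\in((B+1)^{-1},1)$ and $\beta\in(0,1-\alpha)$ be fixed values. Consider the high-privacy regime where $\xi_{\epsilon,\delta}\asymp n^{-1/2-r}$ with fixed $r\in(0,1/2)$. Then the uniform power of $\phi^u_{\mathrm{dpdHSIC}}$ is asymptotically at most $\alpha$ over $\mathcal P_{\mathrm{dHSIC}_{\mathbf k}}(\rho)$, where $$\rho=\log(n)\times\max\Big\{\sqrt{\frac{\max\{\log(1/\alpha),\log(1/\beta)\}}{n}},\ \frac{\max\{\log(1/\alpha),\log(1/\beta)\}}{n\,\xi_{\epsilon,\delta}}\Big\};$$ that is, $$\limsup_{n\to\infty}\ \inf_{P_{X^1,\dots,X^d}\in\mathcal P_{\mathrm{dHSIC}_{\mathbf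 k}}(\rho)}\mathbb E_{P_{X^1,\dots,X^d}}[\phi^u_{\mathrm{dpdHSIC}}]\le\alpha .$$
   Context: Superscripts on $k,K,X,\pi$ are indices, not exponents; $d\ge2$ is fixed. For each $j\in[d]=\{1,\dots,d\}$, $\mathbb X^j$ is a separable topological space on which differences make sense and $k^j$ is a continuous, bounded, positive semi-definite kernel on $\mathbb X^j$ with RKHS $\mathcal H^j$. Translation invariant: $k^j(x,x')=\kappa^j(x-x')$ for a symmetric positive definite function $\kappa^j$; the bound is taken to be $K^j=\kappa^j(0)$. Non-empty level sets: for any $\varepsilon\in(0,K^j)$ there are $x,x'\in\mathbb X^j$ with $k^j(x,x')\le\varepsilon$. The product kernel $\mathbf k((x^j)_j,(x'^j)_j)=\prod_jk^j(x^j,x'^j)$, with RKHS $\mathcal H_{\mathbf k}$ and unit ball $\mathcal F_{\mathbf k}$, is assumed characteristic; the kernels do not depend on $n$. $\mathrm{dHSIC}_{\mathbf k}(P)=\sup_{f\in\mathcal F_{\mathbf k}}\{\mathbb E_P[f]-\mathbb E_{\otimes_jP_{X^j}}[f]\}$ for $P=P_{X^1,\dots,X^d}$ with marginals $P_{X^j}$. $\mathcal P_{\mathrm{dHSIC}_{\mathbf k}}(\rho)=\{P\in\mathcal P_{\mathbb X^1\times\dots\times\mathbb X^d}:\mathrm{dHSIC}_{\mathbf k}(P)\ge\rho\}$. With $\mathbf i_q^n$ the set of $q$-tuples drawn without replacement from $[n]$, $n\ge2d$, and $\mathcal X_n=(\mathbf X_i)_{i\le n}$, $\mathbf X_i=(X_i^1,\dots,X_i^d)$,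 an i.i.d. sample from $P$, $$U_{\mathrm{dHSIC}}(\mathcal X_n)=\frac{(n-2)!}{n!}\sum_{\mathbf i_2^n}\prod_{j=1}^dk^j(X_{i_1}^j,X_{i_2}^j)+\frac{(n-2d)!}{n!}\sum_{\mathbf i_{2d}^n}\prod_{j=1}^dk^j(X_{i_{2j-1}}^j,X_{i_{2j}}^j)-\frac{2(n-d-1)!}{n!}\sum_{\mathbf i_{d+1}^n}\prod_{j=1}^dk^j(X_{i_1}^j,X_{i_{j+1}}^j).$$ For a $d$-tuple $\boldsymbol\pi=(\pi^1,\dots,\pi^d)$ of permutations of $[n]$, $\mathcal X_n^{\boldsymbol\pi}$ has $i$-th element $(X^1_{\pi^1(i)},\dots,X^d_{\pi^d(i)})$. Test $\phi^u_{\mathrm{dpdHSIC}}$: let $\Delta_T$ be the sensitivity $\sup_{\boldsymbol\pi}\sup|U_{\mathrm{dHSIC}}(\mathcal X_n^{\boldsymbol\pi})-U_{\mathrm{dHSIC}}(\tilde{\mathcal X}_n^{\boldsymbol\pi})|$ over all $\boldsymbol\pi$ and all datasets $\mathcal X_n,\tilde{\mathcal X}_n$ differing in at most one observation; $\xi_{\epsilon,\delta}=\epsilon+\log(1/(1-\delta))$ with $\epsilon>0,\delta\in[0,1)$ (depending on $n$); $\boldsymbol\pi_0$ the identity, $\boldsymbol\pi_1,\dots,\boldsymbol\pi_B$ i.i.d. uniform $d$-tuples of permutations, $\zeta_0,\dots,\zeta_B$ i.i.d. standard Laplace (location $0$, scale $1$), all independent of each other and of the data; $M_i=U_{\mathrm{dHSIC}}(\mathcal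 X_n^{\boldsymbol\pi_i})+2\Delta_T\xi_{\epsilon,\delta}^{-1}\zeta_i$; $\hat p_{\mathrm{dp}}=\frac1{B+1}\{\sum_{i=1}^B\mathbb 1(M_i\ge M_0)+1\}$; $\phi^u_{\mathrm{dpdHSIC}}=\mathbb 1(\hat p_{\mathrm{dp}}\le\alpha)$. $a_n\asymp b_n$ means $a_n/b_n$ is bounded above and below by positive constants. *)

(* Defs.v *)
From HB Require Import structures.
From mathcomp Require Import all_boot all_order all_algebra all_fingroup.
From mathcomp Require Import all_classical all_reals all_analysis.
From mathcomp Require Import measurable_realfun.

Set Implicit Arguments.
Unset Strict Implicit.
Unset Printing Implicit Defensive.

Import Order.TTheory GRing.Theory Num.Theory.
Import numFieldNormedType.Exports.

Local Open Scope classical_set_scope.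
Local Open Scope ring_scope.

(* A topological space with an abelian group structure; no continuity of the
   group operations is assumed, only that differences make sense. *)
Notation diffSpace := PreTopologicalZmodule.type.

Definition separable_space (T : topologicalType) : Prop :=
  exists2 D : set T, countable D & dense D.

(* X^1 x ... x X^d with the product of the Borel sigma-algebras. *)
Definition prodspace (d : nat) (X : 'I_d -> diffSpace) : Type :=
  forall j, X j.

Definition borel_cylinders (d : nat) (X : 'I_d -> diffSpace) :
    set (set (prodspace X)) :=
  [set C | exists (j : 'I_d) (A : set (X j)),
     <<s [set U : set (X j) | open U] >> A /\ C = [set x | A (x j)]].

Section prodspace_measurable.
Variables (d : nat) (X : 'I_d -> diffSpace).

HB.instance Definition _ := gen_eqMixin (prodspace X).
HB.instance Definition _ := gen_choiceMixin (prodspace X).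
HB.instance Definition _ :=
  isPointed.Build (prodspace X) (fun j => 0 : X j).

HB.instance Definition _ :=
  @isMeasurable.Build (sigma_display (@borel_cylinders d X)) (prodspace X)
    <<s @borel_cylinders d X >>
    (@sigma_algebra0 _ setT _)
    (@sigma_algebraC (prodspace X) (@borel_cylinders d X))
    (@sigma_algebra_bigcup _ setT _).

End prodspace_measurable.

Section iid.
Context {disp : measure_display} {T : measurableType disp} {R : realType}.

Definition tuple_cons (n : nat) (z : T * n.-tuple T) : n.+1.-tuple T :=
  [the n.+1.-tuple T of z.1 :: z.2].

Lemma measurable_tuple_cons (n : nat) :
  measurable_fun [set: T * n.-tuple T] (@tuple_cons n).
Proof. exact: measurable_cons. Qed.

HB.instance Definition _ (n : nat) :=
  isMeasurableFun.Build _ _ _ _ (@tuple_cons n) (@measurable_tuple_cons n).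

(* The n-fold product P^n (see [iid_box]). *)
Fixpoint iid (P : probability T R) (n : nat) : probability (n.-tuple T) R :=
  match n with
  | 0 => \d_ ([tuple] : 0.-tuple T)
  | m.+1 => distribution (P \x iid P m)%E (@tuple_cons m)
  end.

Lemma iid_box (P : probability T R) (n : nat) (B : 'I_n -> set T) :
  (forall i, measurable (B i)) ->
  iid P n [set t | forall i, B i (tnth t i)] = (\prod_(i < n) P (B i))%E.
Proof.
elim: n B => [|n IHn] B mB.
  rewrite big_ord0 /= (_ : [set _ | _] = setT) ?diracT//.
  by apply/seteqP; split=> // t _ [].
rewrite big_ord_recl -IHn// /= /distribution /pushforward /=.
rewrite (_ : _ @^-1` _ =
    B ord0 `*` [set t : n.-tuple T | forall i, B (lift ord0 i) (tnth t i)]).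
  rewrite product_measure1E//.
  rewrite (_ : [set _ | _] = \bigcap_(i in [set: 'I_n])
      ((fun t : n.-tuple T => tnth t i) @^-1` B (lift ord0 i))).
    apply: fin_bigcap_measurable => // i _.
    rewrite -[X in measurable X]setTI.
    exact: (@measurable_tnth _ T n i).
  by apply/seteqP; split=> t /= Bt i; have := Bt i; last exact.
apply/seteqP; split=> [[x t] /= Bt|[x t] /= [Bx Bt] i].
  split; first exact: (Bt ord0).
  by move=> i; have := Bt (lift ord0 i); rewrite /tuple_cons tnthS.
by case: (unliftP ord0 i) => [j|] ->; rewrite /tuple_cons ?tnthS ?tnth0.
Qed.

End iid.

Section marginals.
Context {R : realType} {d : nat} {X : 'I_d -> diffSpace}.

Definition diagonal_pick (t : d.-tuple (prodspace X)) : prodspace X :=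
  fun j => tnth t j j.

Lemma measurable_diagonal_pick : measurable_fun setT diagonal_pick.
Proof.
apply: (@measurability _ _ _ _ _ _ (@borel_cylinders d X)) => //.
move=> _ [_ [j [A [bA ->]]] <-].
have mA : measurable ([set x | A (x j)] : set (prodspace X)).
  by apply: sub_sigma_algebra; exists j, A.
exact: (@measurable_tnth _ (prodspace X) d j measurableT _ mA).
Qed.

HB.instance Definition _ :=
  isMeasurableFun.Build _ _ _ _ diagonal_pick measurable_diagonal_pick.

(* P_{X^1} (x) ... (x) P_{X^d}: the law of (X_1^1, ..., X_d^d) where
   X_1, ..., X_d are independent with law P (see [prod_marginals_box]). *)
Definition prod_marginals (P : probability (prodspace X) R) :
    probability (prodspace X) R :=
  distribution (iid P d) diagonal_pick.

Lemma prod_marginals_box (P : probability (prodspace X) R)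
    (A : forall j, set (X j)) :
  (forall j, <<s [set U : set (X j) | open U] >> (A j)) ->
  prod_marginals P [set x | forall j, A j (x j)] =
  (\prod_(j < d) P [set x | A j (x j)])%E.
Proof.
move=> bA.
pose B j : set (prodspace X) := [set x | A j (x j)].
transitivity (iid P d [set t | forall j, B j (tnth t j)]) => //.
apply: iid_box => j; apply: sub_sigma_algebra.
by exists j, (A j).
Qed.

End marginals.

Section laplace.
Context {R : realType}.
Local Notation mu := (@lebesgue_measure R).

Definition laplace_pdf (x : R) : R := expR (- `|x|) / 2.

Lemma laplace_pdf_ge0 (x : R) : 0 <= laplace_pdf x.
Proof. by rewrite divr_ge0// expR_ge0. Qed.

Lemma continuous_laplace_pdf : continuous laplace_pdf.
Proof.
move=> x.
apply: (@continuousM _ R^o (fun y => expR (- `|y|)) (fun=> 2^-1)).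
  apply: (@continuous_comp _ _ _ (fun y : R => - `|y|) expR).
    by apply: (@continuousN _ R^o); exact: norm_continuous.
  exact: continuous_expR.
exact: cst_continuous.
Qed.

Lemma measurable_laplace_pdf : measurable_fun [set: R] laplace_pdf.
Proof. exact: continuous_measurable_fun continuous_laplace_pdf. Qed.

Lemma integral_laplace_pdf : (\int[mu]_x (laplace_pdf x)%:E = 1)%E.
Proof.
rewrite ge0_symfun_integralT; first last.
- by move=> x /=; rewrite /laplace_pdf normrN.
- exact: continuous_laplace_pdf.
- exact: laplace_pdf_ge0.
rewrite (_ : [set x : R | 0 <= x] = `[0, +oo[%classic); last first.
  by apply/seteqP; split=> x /=; rewrite in_itv/= andbT.
rewrite -ge0_integralZl//=; last 2 first.
- by apply/measurable_EFinP; apply: measurable_funTS;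
    exact: measurable_laplace_pdf.
- by move=> x _; rewrite lee_fin laplace_pdf_ge0.
rewrite -[RHS](@integral_exponential_pdf R 1 ltr01).
rewrite integral_mkcond; apply: eq_integral => x _.
rewrite patchE /exponential_pdf patchE; case: ifPn => // x0.
rewrite -EFinM; congr EFin; rewrite /laplace_pdf mulrCA divff// mulr1.
by move: x0; rewrite inE/= in_itv/= andbT => /ger0_norm ->; rewrite mul1r mulN1r.
Qed.

Definition laplace_prob (V : set R) : \bar R :=
  (\int[mu]_(x in V) (laplace_pdf x)%:E)%E.

Let laplace0 : laplace_prob set0 = 0%E.
Proof. by rewrite /laplace_prob integral_set0. Qed.

Let laplace_ge0 A : (0 <= laplace_prob A)%E.
Proof. by apply: integral_ge0 => x _; rewrite lee_fin laplace_pdf_ge0. Qed.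

Let laplace_sigma_additive : semi_sigma_additive laplace_prob.
Proof.
move=> A mA tA mUA; rewrite /laplace_prob/= ge0_integral_bigcup//=; last 2 first.
- by apply/measurable_EFinP; apply: measurable_funTS;
    exact: measurable_laplace_pdf.
- by move=> x _; rewrite lee_fin laplace_pdf_ge0.
apply: is_cvg_ereal_nneg_natsum_cond => n _ _.
by apply: integral_ge0 => x _; rewrite lee_fin laplace_pdf_ge0.
Qed.

HB.instance Definition _ := isMeasure.Build _ _ _
  laplace_prob laplace0 laplace_ge0 laplace_sigma_additive.

Let laplace_setT : laplace_prob [set: _] = 1%E.
Proof. exact: integral_laplace_pdf. Qed.

HB.instance Definition _ :=
  @Measure_isProbability.Build _ _ R laplace_prob laplace_setT.

End laplace.

Definition psd_kernel {R : realType} {T : Type} (k : T -> T -> R) : Prop :=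
  (forall x y, k x y = k y x) /\
  (forall (m : nat) (x : 'I_m -> T) (c : 'I_m -> R),
     0 <= \sum_(a < m) \sum_(b < m) c a * c b * k (x a) (x b)).

Definition posdef_fun {R : realType} {V : zmodType} (kappa : V -> R) : Prop :=
  (forall x, kappa (- x) = kappa x) /\
  (forall (m : nat) (x : 'I_m -> V) (c : 'I_m -> R),
     0 <= \sum_(a < m) \sum_(b < m) c a * c b * kappa (x a - x b)).

(* A Hilbert space [rkhs_set] of functions, with inner product [rkhs_ip]
   (meaningful on [rkhs_set] only), in which [k x] represents evaluation at x. *)
Record rkhs (R : realType) (T : Type) (k : T -> T -> R) := RKHS {
  rkhs_set : set (T -> R) ;
  rkhs_ip : (T -> R) -> (T -> R) -> R ;
  rkhs_norm := fun f : T -> R => Num.sqrt (rkhs_ip f f) ;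
  rkhs_set0 : rkhs_set (fun _ => 0) ;
  rkhs_setD : forall (a : R) f g, rkhs_set f -> rkhs_set g ->
    rkhs_set (fun x => a * f x + g x) ;
  rkhs_ipC : forall f g, rkhs_set f -> rkhs_set g ->
    rkhs_ip f g = rkhs_ip g f ;
  rkhs_ipD : forall (a : R) f g h, rkhs_set f -> rkhs_set g -> rkhs_set h ->
    rkhs_ip (fun x => a * f x + g x) h = a * rkhs_ip f h + rkhs_ip g h ;
  rkhs_ip_ge0 : forall f, rkhs_set f -> 0 <= rkhs_ip f f ;
  rkhs_ip_eq0 : forall f, rkhs_set f -> rkhs_ip f f = 0 -> forall x, f x = 0 ;
  rkhs_complete : forall u : nat -> T -> R, (forall n, rkhs_set (u n)) ->
    (forall e : R, 0 < e -> exists N, forall m n, (N <= m)%N -> (N <= n)%N ->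
       rkhs_norm (fun x => u m x - u n x) < e) ->
    exists2 f, rkhs_set f &
      forall e : R, 0 < e -> exists N, forall n, (N <= n)%N ->
        rkhs_norm (fun x => u n x - f x) < e ;
  rkhs_kernel : forall x, rkhs_set (k x) ;
  rkhs_reproducing : forall f x, rkhs_set f -> rkhs_ip f (k x) = f x
}.

Section dHSIC.
Context {R : realType} {d : nat} {X : 'I_d -> diffSpace}.
Variable k : forall j, X j -> X j -> R.

Definition prod_kernel (x y : prodspace X) : R := \prod_(j < d) k (x j) (y j).

Variable H : rkhs prod_kernel.

Definition unit_ball : set (prodspace X -> R) :=
  [set f | rkhs_set H f /\ rkhs_norm H f <= 1].

Definition mean_embedding (P : probability (prodspace X) R)
    (m : prodspace X -> R) : Prop :=
  rkhs_set H m /\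
  forall f, rkhs_set H f -> ('E_P[f] = (rkhs_ip H m f)%:E)%E.

(* Injectivity of P |-> mean embedding of P; measures are compared on measurable
   sets, since the underlying set functions are arbitrary elsewhere. *)
Definition characteristic_kernel : Prop :=
  forall (P Q : probability (prodspace X) R) m,
    mean_embedding P m -> mean_embedding Q m ->
    forall A, measurable A -> P A = Q A.

Definition dHSIC (P : probability (prodspace X) R) : \bar R :=
  ereal_sup [set ('E_P[f] - 'E_(prod_marginals P)[f])%E | f in unit_ball].

End dHSIC.

(* 0-based counterparts of the indices 2j-1 and 2j in {1, ..., 2d}. *)
Lemma pair_index_subproof (d : nat) (j : 'I_d) (b : bool) :
  (2 * j + b < 2 * d)%N.
Proof.
apply: (@leq_trans (2 * j.+1)); last by rewrite leq_mul2l /= ltn_ord.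
by rewrite mulnS addnC ltn_add2r; case: b.
Qed.

Definition pair_index (d : nat) (j : 'I_d) (b : bool) : 'I_(2 * d) :=
  Ordinal (pair_index_subproof j b).

Section test.
Context {R : realType} {d : nat} {X : 'I_d -> diffSpace}.
Variable k : forall j, X j -> X j -> R.
Variable n : nat.

Local Notation dataset := ('I_n -> prodspace X).
Local Notation dperm := {ffun 'I_d -> 'S_n}.

Definition U_dHSIC (x : dataset) : R :=
  (n - 2)`!%:R / n`!%:R *
    (\sum_(i : {ffun 'I_2 -> 'I_n} | injectiveb i)
       \prod_(j < d) k (x (i ord0) j) (x (i ord_max) j))
  + (n - 2 * d)`!%:R / n`!%:R *
    (\sum_(i : {ffun 'I_(2 * d) -> 'I_n} | injectiveb i)
       \prod_(j < d) k (x (i (pair_index j false)) j)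
                       (x (i (pair_index j true)) j))
  - 2 * (n - d - 1)`!%:R / n`!%:R *
    (\sum_(i : {ffun 'I_d.+1 -> 'I_n} | injectiveb i)
       \prod_(j < d) k (x (i ord0) j) (x (i (lift ord0 j)) j)).

Definition permute (pi : dperm) (x : dataset) : dataset :=
  fun i j => x (pi j i) j.

Definition id_perm : dperm := [ffun _ => 1%g].

Definition neighbours (x y : dataset) : Prop :=
  exists i0 : 'I_n, forall i, i != i0 -> x i = y i.

(* For bounded kernels the set is bounded, so that [sup] is the supremum. *)
Definition sensitivity : R :=
  sup [set s | exists (pi : dperm) (x y : dataset), neighbours x y /\
         s = `|U_dHSIC (permute pi x) - U_dHSIC (permute pi y)|].

Variable B : nat.
Variables (xi alpha : R).

(* M_0 uses the identity, M_{b+1} the permutation pi b. *)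
Definition noisy_stat (x : dataset) (pi : {ffun 'I_B -> dperm})
    (zeta : 'I_B.+1 -> R) (b : 'I_B.+1) : R :=
  U_dHSIC (permute (oapp pi id_perm (unlift ord0 b)) x)
  + 2 * sensitivity * xi^-1 * zeta b.

Definition dp_pvalue (x : dataset) (pi : {ffun 'I_B -> dperm})
    (zeta : 'I_B.+1 -> R) : R :=
  (B.+1)%:R^-1 *
  (\sum_(b < B) ((noisy_stat x pi zeta ord0 <=
                  noisy_stat x pi zeta (lift ord0 b))%R : bool)%:R + 1).

Definition dp_test (x : dataset) (pi : {ffun 'I_B -> dperm})
    (zeta : 'I_B.+1 -> R) : R :=
  ((dp_pvalue x pi zeta <= alpha)%R : bool)%:R.

(* Expectation of the test when the data are i.i.d. from P, the noise is i.i.d.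
   Laplace and pi is uniform over B-tuples of d-tuples of permutations, all
   independent. *)
Definition dp_power (P : probability (prodspace X) R) : \bar R :=
  ((#|{: {ffun 'I_B -> dperm}}|%:R^-1)%:E *
   \sum_(pi : {ffun 'I_B -> dperm})
     'E_(iid P n \x iid (@laplace_prob R) B.+1)
       [fun z => dp_test (tnth z.1) pi (tnth z.2)])%E.

End test.

Definition privacy_xi {R : realType} (eps delta : R) : R :=
  eps + ln (1 / (1 - delta)).

Definition same_order {R : realType} (a b : nat -> R) : Prop :=
  exists c C : R, [/\ 0 < c, 0 < C &
    \forall n \near \oo, c <= a n / b n <= C].

(* Main.v *)
Require Import Defs.
From HB Require Import structures.
From mathcomp Require Import all_boot all_order all_algebra.
From mathcomp Require Import all_classical all_reals all_analysis.
From mathcomp Require Import perm measurable_realfun ring lra.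
Set Implicit Arguments.
Unset Strict Implicit.
Unset Printing Implicit Defensive.
Import Order.TTheory GRing.Theory Num.Theory.
Import numFieldNormedType.Exports.
Local Open Scope classical_set_scope.
Local Open Scope ring_scope.

(** The hard alternative [Q] is the mixture of a fixed dependent law [P], with
    [dHSIC H P = rho0], and of the product of the marginals of [P], with weight
    [w = 2 rho n / rho0] on [P]. All these mixtures have the same marginals, so
    dHSIC is linear in [w] ([dHSIC_mixture]) and [Q] lies at distance at least
    [rho n], whereas the mean of [U_dHSIC] is quadratic in [w]
    ([mean_U_mixture]). With [xi] of order [n ^ (-1/2 - r)], the noise added to
    the statistics has scale [sensitivity / xi], at least of order
    [n ^ (-1/2 + r)], while [w ^ 2] is of order [(ln n) ^ 2 * n ^ (-1 + 2r)]. Since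
    [r < 1/2], the noise drowns the signal ([high_privacy_rates]).

    The test therefore behaves as if it ranked the noise alone. The unpermuted
    statistic is small with probability close to [1], by Markov's inequality
    ([U_dHSIC_markov]). The permuted ones are handled without any moment
    computation: [U_dHSIC] is within [O(1/n)] of the corresponding V-statistic,
    which is a squared norm in the RKHS, so that [U_dHSIC] is at least [- C / n]
    on every sample ([U_V_approx], [embedding_gap_ge0], [U_dHSIC_lower]). Hence
    the [i]-th noisy statistic exceeds the unpermuted one as soon as [zeta i]
    exceeds [zeta 0] by a small [s] ([dp_test_bad]). As the noise is
    exchangeable, [zeta 0] belongs to the top fraction [alpha] with probability at
    most [alpha], and near ties cost at most [B * s] ([bad_noise_prob]).
    Letting [s] tend to [0] gives the bound.

    That the noise is as large as claimed rests on a lower bound of order [1/n]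
    for the sensitivity ([sensitivity_lower]). The statistic is [0] on a constant
    sample and bounded away from [0] on a sample split between two points whose
    features are nearly orthogonal in each coordinate; at most [n] single changes
    lead from one sample to the other, and one of them changes the statistic by
    a constant over [n].

    On the measure-theoretic side, the spaces are merely separable. Functions of
    the RKHS and the product kernel are measurable because they are Lipschitz
    for the distance between features, for which the space is separable
    ([measurable_lipschitz], [rkhs_bmeas], [pk_bmeas]). Laws of points assembled
    from different observations are identified on boxes ([pick_law2]). *)

(** * Means of bounded measurable functions *)

Lemma measurable_ler_set {disp} {T : measurableType disp} {R : realType}
    (f g : T -> R) : measurable_fun setT f -> measurable_fun setT g ->
  measurable [set x | f x <= g x].
Proof.
move=> mf mg; have mgf := measurable_funB mg mf.
have := mgf measurableT `[0, +oo[%classic (measurable_itv _).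
rewrite setTI; congr (measurable _).
by apply/seteqP; split=> x /=; rewrite in_itv/= andbT subr_ge0.
Qed.

Import HBNNSimple.

Section bounded_means.
Context {d : measure_display} {T : measurableType d} {R : realType}.
Implicit Types (P Q M : probability T R) (f g : T -> R).

(** Bounded measurable integrands: their means under a probability are finite and
    linear without further conditions. *)
Definition bmeas f : Prop :=
  measurable_fun [set: T] f /\ exists K : R, forall x, `|f x| <= K.

Lemma bmeas_integrable P f : bmeas f -> P.-integrable setT (EFin \o f).
Proof.
move=> [mf [K fK]]; apply: measurable_bounded_integrable => //.
  by apply: le_lt_trans (probability_le1 P measurableT) _; rewrite ltry.
exists K; split; first exact: num_real.
by move=> x Kx y _; exact: le_trans (fK y) (ltW Kx).
Qed.

Lemma bmeas_cst (c : R) : bmeas (fun=> c).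
Proof. by split; [exact: measurable_cst | exists `|c|]. Qed.

Lemma bmeasD f g : bmeas f -> bmeas g -> bmeas (fun x => f x + g x).
Proof.
move=> [mf [K fK]] [mg [L gL]]; split; first exact: measurable_funD.
by exists (K + L) => x; exact: le_trans (ler_normD _ _) (lerD _ _).
Qed.

Lemma bmeasZ (c : R) f : bmeas f -> bmeas (fun x => c * f x).
Proof.
move=> [mf [K fK]]; split; first exact: measurable_funM.
by exists (`|c| * K) => x; rewrite normrM ler_wpM2l.
Qed.

Lemma bmeas_sum (I : Type) (s : seq I) (p : pred I) (F : I -> T -> R) :
  (forall i, p i -> bmeas (F i)) -> bmeas (fun x => \sum_(i <- s | p i) F i x).
Proof.
move=> bF; elim: s => [|i s IHs].
  have -> : (fun x => \sum_(i <- [::] | p i) F i x) = fun=> 0.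
    by apply/funext => x; rewrite big_nil.
  exact: bmeas_cst.
have -> : (fun x => \sum_(j <- i :: s | p j) F j x) = fun x => if p i
    then F i x + \sum_(j <- s | p j) F j x else \sum_(j <- s | p j) F j x.
  by apply/funext => x; rewrite big_cons.
by case: (boolP (p i)) => // pi; apply: bmeasD => //; exact: bF.
Qed.

Lemma meanD P f g : bmeas f -> bmeas g ->
  \int[P]_x (f x + g x) = \int[P]_x f x + \int[P]_x g x.
Proof. by move=> bf bg; rewrite RintegralD//; exact: bmeas_integrable. Qed.

Lemma meanZ P (c : R) f : bmeas f -> \int[P]_x (c * f x) = c * \int[P]_x f x.
Proof. by move=> bf; rewrite RintegralZl//; exact: bmeas_integrable. Qed.

Lemma mean_cst P (c : R) : \int[P]_x c = c.
Proof.
rewrite Rintegral_cst//.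
by rewrite (_ : fine _ = 1) ?mulr1//; rewrite -[RHS]/(fine 1%E) -(probability_setT P).
Qed.

Lemma mean_sum P (I : Type) (s : seq I) (p : pred I) (F : I -> T -> R) :
  (forall i, p i -> bmeas (F i)) ->
  \int[P]_x (\sum_(i <- s | p i) F i x) = \sum_(i <- s | p i) \int[P]_x F i x.
Proof.
move=> bF; elim: s => [|i s IHs].
  rewrite big_nil -[RHS](mean_cst P); apply: eq_Rintegral => x _.
  by rewrite big_nil.
rewrite big_cons; transitivity (\int[P]_x (if p i
    then F i x + \sum_(j <- s | p j) F j x else \sum_(j <- s | p j) F j x)).
  by apply: eq_Rintegral => x _; rewrite big_cons.
case: (boolP (p i)) => // pi.
by rewrite meanD ?IHs//; [exact: bF | exact: bmeas_sum].
Qed.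

Lemma expectation_mean P f : bmeas f -> ('E_P[f] = (\int[P]_x f x)%:E)%E.
Proof.
move=> bf; rewrite unlock /Rintegral fineK//.
exact: integrable_fin_num (bmeas_integrable P bf).
Qed.

Lemma eq_measure_mean P Q f : (forall A, measurable A -> P A = Q A) ->
  \int[P]_x f x = \int[Q]_x f x.
Proof.
by move=> PQ; rewrite /Rintegral; congr fine;
  apply: eq_measure_integral => A mA _; exact: PQ.
Qed.

Lemma ge0_mean_mixture P Q M (w : R) f : 0 <= w <= 1 ->
  (forall A, measurable A -> M A = (w%:E * P A + (1 - w)%:E * Q A)%E) ->
  bmeas f -> (forall x, 0 <= f x) ->
  \int[M]_x f x = w * \int[P]_x f x + (1 - w) * \int[Q]_x f x.
Proof.
move=> /andP[w0 w1] ME bf f0; apply: EFin_inj.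
have w1' : 0 <= 1 - w by rewrite subr_ge0.
have fE (N : probability T R) : (\int[N]_x f x)%:E = (\int[N]_x (f x)%:E)%E :> \bar R.
  by rewrite /Rintegral fineK//; exact: integrable_fin_num (bmeas_integrable N bf).
have mf : measurable_fun setT (EFin \o f).
  by apply/measurable_EFinP; exact: bf.1.
rewrite EFinD !EFinM !fE.
rewrite (eq_measure_integral (measure_add (mscale (NngNum w0) P)
  (mscale (NngNum w1') Q))) => [|A mA _]; last first.
  by move: (ME A mA) => /= ->; rewrite /measure_add /msum 2!big_ord_recl/= big_ord0 adde0.
rewrite ge0_integral_measure_add//; last by move=> x _; rewrite lee_fin.
by rewrite !ge0_integral_mscale// => x _; rewrite lee_fin.
Qed.

Lemma mean_mixture P Q M (w : R) f : 0 <= w <= 1 ->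
  (forall A, measurable A -> M A = (w%:E * P A + (1 - w)%:E * Q A)%E) ->
  bmeas f ->
  \int[M]_x f x = w * \int[P]_x f x + (1 - w) * \int[Q]_x f x.
Proof.
move=> w01 ME bf; have [K fK] := bf.2.
(* a constant shift makes the integrand nonnegative *)
have bfK : bmeas (fun x => f x + K) by apply: bmeasD => //; exact: bmeas_cst.
have := ge0_mean_mixture w01 ME bfK.
rewrite !meanD ?mean_cst//; try exact: bmeas_cst.
have fK0 x : 0 <= f x + K by have := fK x; rewrite ler_norml => /andP[]; lra.
by move=> /(_ fK0); lra.
Qed.

(** The integral of a nonnegative function is the supremum of the integrals of
    the simple functions below it, and these are at most [P A]. *)
Lemma integral_le_prob P (f : T -> R) (A : set T) : measurable A ->
  (forall x, 0 <= f x <= \1_A x) -> (\int[P]_x (f x)%:E <= P A)%E.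
Proof.
move=> mA fA.
rewrite ge0_integralTE; last by move=> x; rewrite lee_fin; case/andP: (fA x).
apply: ge_ereal_sup => _ [h/= hf <-].
rewrite -integralT_nnsfun.
apply: (@le_trans _ _ (\int[P]_x (\1_A x)%:E)%E).
  apply: ge0_le_integral => //.
  - by move=> x _; rewrite lee_fin; exact: fun_ge0.
  - by apply/measurable_EFinP; exact: measurable_funP.
  - by apply/measurable_EFinP; exact: measurable_indic.
  - move=> x _; rewrite lee_fin; case/andP: (fA x) => _; apply: le_trans.
    by have := hf x; rewrite lee_fin.
by rewrite integral_indic// setIT.
Qed.

Lemma mean_markov P f (t : R) : bmeas f -> (forall x, 0 <= f x) -> 0 < t ->
  (P [set x | t <= f x]%R <= (t^-1 * \int[P]_x f x)%:E)%E.
Proof.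
move=> bf f0 t0.
have mA : measurable [set x | t <= f x].
  by apply: measurable_ler_set => //; exact: bf.1.
rewrite -meanZ// /Rintegral fineK; last first.
  exact: integrable_fin_num (bmeas_integrable P (bmeasZ _ bf)).
rewrite -[X in (P X <= _)%E]setIT -integral_indic//.
apply: ge0_le_integral => //.
- exact/measurable_EFinP.
- by apply/measurable_EFinP; exact: (bmeasZ _ bf).1.
- move=> x _; rewrite lee_fin indicE; case: (boolP (_ \in _)) => /=.
    by rewrite inE/= => tf; rewrite mulrC ler_pdivlMr ?mul1r.
  by move=> _; rewrite mulr_ge0// invr_ge0 ltW.
Qed.

End bounded_means.

Lemma bmeas_comp {d1 d2} {T1 : measurableType d1} {T2 : measurableType d2}
    {R : realType} (phi : T1 -> T2) (f : T2 -> R) :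
  measurable_fun setT phi -> bmeas f -> bmeas (f \o phi).
Proof.
move=> mphi [mf [K fK]]; split; first exact: measurableT_comp.
by exists K => x; exact: fK.
Qed.

Lemma mean_distribution {d1 d2} {T1 : measurableType d1}
    {T2 : measurableType d2} {R : realType} (P : probability T1 R)
    (Q : probability T2 R) (phi : T1 -> T2) (f : T2 -> R) :
  measurable_fun setT phi ->
  (forall A, measurable A -> P (phi @^-1` A) = Q A) -> bmeas f ->
  \int[P]_x f (phi x) = \int[Q]_y f y.
Proof.
move=> mphi PQ bf; rewrite /Rintegral; congr fine.
rewrite (eq_measure_integral (pushforward P phi)) => [|A mA _]; last first.
  by rewrite /= /pushforward PQ.
rewrite integral_pushforward//.
- by apply/measurable_EFinP; exact: bf.1.
- by rewrite preimage_setT; exact: (bmeas_integrable P (bmeas_comp mphi bf)).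
Qed.

Lemma mean_fubini {d1 d2} {T1 : measurableType d1} {T2 : measurableType d2}
    {R : realType} (P : probability T1 R) (Q : probability T2 R)
    (f : T1 * T2 -> R) : bmeas f -> (forall z, 0 <= f z) ->
  [/\ forall x, bmeas (fun y => f (x, y)),
      bmeas (fun x => \int[Q]_y f (x, y)) &
      \int[(P \x Q)%E]_z f z = \int[P]_x \int[Q]_y f (x, y)].
Proof.
move=> bf f0; have [K fK] := bf.2.
have bx x : bmeas (fun y => f (x, y)).
  split; last by exists K => y; exact: fK.
  exact: measurableT_comp bf.1 (measurable_pair1 _).
have mE : measurable_fun setT (EFin \o f) by apply/measurable_EFinP; exact: bf.1.
have E0 z : (0 <= (EFin \o f) z)%E by rewrite lee_fin.
have FE x : fubini_F Q (EFin \o f) x = (\int[Q]_y f (x, y))%:E.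
  rewrite /fubini_F /Rintegral fineK//.
  exact: integrable_fin_num (bmeas_integrable Q (bx x)).
split=> //; first split.
- have := measurable_fun_fubini_tonelli_F (m2 := Q) (EFin \o f) mE E0.
  by rewrite (_ : fubini_F _ _ = EFin \o (fun x => \int[Q]_y f (x, y)));
    [move/measurable_EFinP | exact/funext].
- exists K => x; rewrite ger0_norm; last by apply: Rintegral_ge0.
  rewrite -[leRHS](mean_cst Q); apply: le_Rintegral => //.
  + exact: bmeas_integrable.
  + by apply: bmeas_integrable; exact: bmeas_cst.
  + by move=> y _; exact: le_trans (ler_norm _) (fK _).
- rewrite /Rintegral; congr fine; rewrite (fubini_tonelli1 (EFin \o f))//.
  by apply: eq_integral => x _; rewrite FE.
Qed.

Lemma mean_fubini_swap {d1 d2} {T1 : measurableType d1} {T2 : measurableType d2}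
    {R : realType} (P : probability T1 R) (Q : probability T2 R)
    (f : T1 * T2 -> R) : bmeas f -> (forall z, 0 <= f z) ->
  bmeas (fun y => \int[P]_x f (x, y)) /\
  \int[(P \x Q)%E]_z f z = \int[Q]_y \int[P]_x f (x, y).
Proof.
move=> bf f0; have [K fK] := bf.2.
have mE : measurable_fun setT (EFin \o f) by apply/measurable_EFinP; exact: bf.1.
have E0 z : (0 <= (EFin \o f) z)%E by rewrite lee_fin.
have by' y : bmeas (fun x => f (x, y)).
  split; last by exists K => x; exact: fK.
  exact: measurableT_comp bf.1 (measurable_pair2 _).
have GE y : fubini_G P (EFin \o f) y = (\int[P]_x f (x, y))%:E.
  rewrite /fubini_G /Rintegral fineK//.
  exact: integrable_fin_num (bmeas_integrable P (by' y)).
split; first split.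
- have := measurable_fun_fubini_tonelli_G (m1 := P) (EFin \o f) mE E0.
  by rewrite (_ : fubini_G _ _ = EFin \o (fun y => \int[P]_x f (x, y)));
    [move/measurable_EFinP | exact/funext].
- exists K => y; rewrite ger0_norm; last by apply: Rintegral_ge0.
  rewrite -[leRHS](mean_cst P); apply: le_Rintegral => //.
  + exact: bmeas_integrable.
  + by apply: bmeas_integrable; exact: bmeas_cst.
  + by move=> x _; exact: le_trans (ler_norm _) (fK _).
- rewrite /Rintegral; congr fine; rewrite (fubini_tonelli2 (EFin \o f))//.
  by apply: eq_integral => y _; rewrite GE.
Qed.

(** * Laws of points assembled from the observations *)

(** The inclusion of the measurable sets in the generated sigma-algebra is
    obtained, in the applications below, from the measurability of the identity
    map. *)
Lemma eq_probability_generated {disp} {T : measurableType disp} {R : realType}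
    (G : set (set T)) (P Q : probability T R) :
  setI_closed G -> G setT -> (forall A, G A -> measurable A) ->
  (forall A, measurable A -> <<s G >> A) -> (forall A, G A -> P A = Q A) ->
  forall A, measurable A -> P A = Q A.
Proof.
move=> GI GT Gm mG PQ; apply: (measure_unique G (fun=> setT)) => //.
- apply/seteqP; split=> A; first exact: mG.
  by apply: smallest_sub; [exact: sigma_algebra_measurable | exact: Gm].
- exact: bigcup_const.
- move=> _; apply: (le_lt_trans (probability_le1 P measurableT)); exact: ltry.
Qed.

Section boxes.
Context {R : realType} {d : nat} {X : 'I_d -> diffSpace}.
Local Notation space := (prodspace X).

(** Events on a single coordinate, seen in the whole space: boxes of such events
    form a family indexed by [j] without dependent types. *)
Definition coord_event (j : 'I_d) (C : set space) : Prop :=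
  exists A : set (X j), <<s [set U | open U] >> A /\ C = [set x | A (x j)].

Definition box (A : 'I_d -> set space) : set space :=
  [set x | forall j, A j x].

Lemma measurable_coord_event j C : coord_event j C -> measurable C.
Proof. by move=> [A AC]; apply: sub_sigma_algebra; exists j, A. Qed.

Lemma coord_eventT j : coord_event j setT.
Proof.
exists setT; split; last by apply/seteqP.
by apply: sub_sigma_algebra; exact: openT.
Qed.

Lemma coord_eventI j C D :
  coord_event j C -> coord_event j D -> coord_event j (C `&` D).
Proof.
move=> [A [bA ->]] [B [bB ->]]; exists (A `&` B); split=> //.
have /sigma_algebraP[//|_ _ _] :=
  smallest_sigma_algebra setT [set U : set (X j) | open U].
exact.
Qed.

Lemma coord_event_eq j C (x y : space) :
  coord_event j C -> x j = y j -> C x -> C y.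
Proof. by move=> [A [_ ->]] /= ->. Qed.

Lemma measurable_box A : (forall j, coord_event j (A j)) -> measurable (box A).
Proof.
move=> cA; rewrite (_ : box A = \bigcap_(j in [set: 'I_d]) A j).
  apply: fin_bigcap_measurable => // j _.
  exact: measurable_coord_event (cA j).
by apply/seteqP; split=> x /= Ax j => [_|]; exact: Ax.
Qed.

Lemma boxI A B : box A `&` box B = box (fun j => A j `&` B j).
Proof.
apply/seteqP; split=> x /= => [[Ax Bx] j|ABx]; first by split.
by split=> j; case: (ABx j).
Qed.

Lemma boxT : box (fun=> setT) = setT.
Proof. by apply/seteqP; split. Qed.

Definition single_box (j : 'I_d) (C : set space) (i : 'I_d) : set space :=
  if i == j then C else setT.

Lemma box_single j C : box (single_box j C) = C.
Proof.
apply/seteqP; split=> x /= Cx; first by have := Cx j; rewrite /single_box eqxx.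
by move=> i; rewrite /single_box; case: ifP.
Qed.

Lemma coord_event_single j C : coord_event j C ->
  forall i, coord_event i (single_box j C i).
Proof.
move=> cC i; rewrite /single_box; case: eqP => [->//|_]; exact: coord_eventT.
Qed.

Lemma prod_marginals_coord (P : probability space R) A :
  (forall j, coord_event j (A j)) ->
  prod_marginals P (box A) = (\prod_(j < d) P (A j))%E.
Proof.
move=> cA; pose D j := projT1 (cid (cA j)).
have DA j : <<s [set U | open U] >> (D j) /\ A j = [set x | D j (x j)].
  exact: projT2 (cid (cA j)).
have -> : box A = [set x | forall j, D j (x j)].
  by apply/seteqP; split=> x /= Ax j; have := Ax j; rewrite (DA j).2.
rewrite prod_marginals_box; last by move=> j; exact: (DA j).1.
by apply: eq_bigr => j _; rewrite -(DA j).2.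
Qed.

Lemma prod_marginals_single (P : probability space R) j C : coord_event j C ->
  prod_marginals P C = P C.
Proof.
move=> cC; rewrite -{1}(box_single j C).
rewrite prod_marginals_coord; last exact: coord_event_single.
rewrite (bigD1 j)//= /single_box eqxx big1 ?mule1// => i /negPf ->.
exact: probability_setT.
Qed.

Lemma eq_probability_box (P Q : probability space R) :
  (forall A, (forall j, coord_event j (A j)) -> P (box A) = Q (box A)) ->
  forall C, measurable C -> P C = Q C.
Proof.
move=> PQ; apply: (@eq_probability_generated _ _ _
  [set C | exists2 A, forall j, coord_event j (A j) & C = box A]).
- move=> _ _ [A cA ->] [B cB ->]; rewrite boxI; eexists; last by [].
  by move=> j; exact: coord_eventI.
- by exists (fun=> setT); [exact: coord_eventT | rewrite boxT].
- by move=> _ [A cA ->]; exact: measurable_box.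
- apply: sub_sigma_algebra2 => _ [j [A [bA ->]]].
  have cC : coord_event j [set x : space | A (x j)] by exists A.
  by eexists; [exact: coord_event_single cC | rewrite box_single].
- by move=> _ [A cA ->]; exact: PQ.
Qed.

Lemma eq_probability_box2 (P Q : probability (space * space)%type R) :
  (forall A B, (forall j, coord_event j (A j)) ->
     (forall j, coord_event j (B j)) ->
     P (box A `*` box B) = Q (box A `*` box B)) ->
  forall C, measurable C -> P C = Q C.
Proof.
move=> PQ.
pose G : set (set (space * space)) := [set C | exists A B,
  [/\ forall j, coord_event j (A j), forall j, coord_event j (B j) &
      C = box A `*` box B]].
apply: (@eq_probability_generated _ _ _ G).
- move=> _ _ [A [B [cA cB ->]]] [A' [B' [cA' cB' ->]]].
  rewrite -setXI !boxI; do 2 eexists; split; last by [].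
  + by move=> j; exact: coord_eventI.
  + by move=> j; exact: coord_eventI.
- exists (fun=> setT), (fun=> setT); rewrite boxT setXTT.
  by split=> // j; exact: coord_eventT.
- by move=> _ [A [B [cA cB ->]]]; apply: measurableX; exact: measurable_box.
- move=> C mC.
  (* the identity is measurable from <<s G>>, as both projections are *)
  have m1 : measurable_fun setT (fst : g_sigma_algebraType G -> space).
    apply: (@measurability _ _ _ _ _ _ (@borel_cylinders d X)) => //.
    move=> _ [_ [j [A [bA ->]]] <-]; apply: sub_sigma_algebra.
    exists (single_box j [set x : space | A (x j)]), (fun=> setT); split.
    + by apply: coord_event_single; exists A.
    + by move=> i; exact: coord_eventT.
    + by rewrite box_single boxT setTI; apply/seteqP; split=> [[x y]|[x y] []].
  have m2 : measurable_fun setT (snd : g_sigma_algebraType G -> space).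
    apply: (@measurability _ _ _ _ _ _ (@borel_cylinders d X)) => //.
    move=> _ [_ [j [A [bA ->]]] <-]; apply: sub_sigma_algebra.
    exists (fun=> setT), (single_box j [set x : space | A (x j)]); split.
    + by move=> i; exact: coord_eventT.
    + by apply: coord_event_single; exists A.
    + by rewrite box_single boxT setTI; apply/seteqP; split=> [[x y]|[x y] []].
  have mid := measurable_fun_pair m1 m2.
  have := mid measurableT C mC; rewrite setTI.
  by rewrite (_ : _ @^-1` C = C)//; apply/seteqP; split=> [[x y]|[x y]].
- by move=> _ [A [B [cA cB ->]]]; exact: PQ.
Qed.

(** Each marginal of a mixture of [P] and of the product of its marginals is a
    mixture of the same marginal of [P] with itself. *)
Lemma prod_marginals_mixture (P Q : probability space R) (w : R) :
  0 <= w <= 1 ->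
  (forall A, measurable A ->
    Q A = (w%:E * P A + (1 - w)%:E * prod_marginals P A)%E) ->
  forall A, measurable A -> prod_marginals Q A = prod_marginals P A.
Proof.
move=> /andP[w0 w1] QE; apply: eq_probability_box => A cA.
rewrite !prod_marginals_coord//; apply: eq_bigr => j _.
rewrite QE; last exact: measurable_coord_event (cA j).
rewrite (prod_marginals_single _ (cA j)) -ge0_muleDl ?lee_fin ?subr_ge0//.
by rewrite -EFinD addrC subrK mul1e.
Qed.

End boxes.

Section picks.
Context {R : realType} {d : nat} {X : 'I_d -> diffSpace}.
Local Notation space := (prodspace X).
Variables (P : probability space R) (n : nat).
Implicit Types a b : 'I_d -> 'I_n.

Definition pick a (x : 'I_n -> space) : space := fun j => x (a j) j.

Lemma measurable_pick a :
  measurable_fun setT (fun t : n.-tuple space => pick a (tnth t)).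
Proof.
apply: (@measurability _ _ _ _ _ _ (@borel_cylinders d X)) => //.
move=> _ [_ [j [A [bA ->]]] <-].
have mA : measurable ([set x | A (x j)] : set space).
  by apply: sub_sigma_algebra; exists j, A.
exact: (@measurable_tnth _ space n (a j) measurableT _ mA).
Qed.

Lemma measurable_pick2 a b : measurable_fun setT
  (fun t : n.-tuple space => (pick a (tnth t), pick b (tnth t))).
Proof. by apply: measurable_fun_pair; exact: measurable_pick. Qed.

(** What the box [A], tested on the point picked by [a], requires of observation
    [l]. *)
Definition slice a (A : 'I_d -> set space) (l : 'I_n) : set space :=
  [set x | forall j, a j = l -> A j x].

Lemma measurable_slice a A l :
  (forall j, coord_event j (A j)) -> measurable (slice a A l).
Proof.
move=> cA.
rewrite (_ : slice a A l = \bigcap_(j in [set j | a j = l]) A j).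
  by apply: fin_bigcap_measurable => // j _; exact: measurable_coord_event (cA j).
by apply/seteqP; split=> x /= Ax j => [|ajl]; exact: Ax.
Qed.

Lemma slice_notin a A l : (forall j, a j != l) -> slice a A l = setT.
Proof.
by move=> al; apply/seteqP; split=> // x _ j /eqP; rewrite (negPf (al j)).
Qed.

(** The two kinds of index families that occur: a single observation gives a
    point of law [P], distinct observations give a point with independent
    coordinates. *)
Definition pick_law a (Q : probability space R) : Prop :=
  (exists2 i, a = (fun=> i) & Q = P) \/ injective a /\ Q = prod_marginals P.

Lemma prod_slice a Q A : pick_law a Q -> (forall j, coord_event j (A j)) ->
  (\prod_(l < n) P (slice a A l))%E = Q (box A).
Proof.
move=> [[i -> ->] | [ia ->]] cA.
  rewrite (bigD1 i)//= big1 => [|l li]; last first.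
    by rewrite slice_notin ?probability_setT// => j; rewrite eq_sym.
  rewrite mule1; congr (P _).
  by apply/seteqP; split=> x /= Ax j => [|_]; exact: Ax.
rewrite prod_marginals_coord// (bigID (mem (codom a)))/=.
rewrite [X in (_ * X)%E]big1 => [|l]; last first.
  move=> la; rewrite slice_notin ?probability_setT// => j.
  by apply: contra la => /eqP <-; exact: codom_f.
rewrite mule1 -big_uniq; last by rewrite map_inj_uniq// enum_uniq.
rewrite big_map big_enum/=.
apply: eq_bigr => j _; congr (P _).
by apply/seteqP; split=> x /= Ax => [|k /ia ->//]; exact: Ax.
Qed.

(** Each observation constrains at most one of the two picked points, so the
    probability of a pair of boxes factors over the observations. *)
Lemma pick_law2 a b Qa Qb : pick_law a Qa -> pick_law b Qb ->
  (forall i j, a i != b j) -> forall C, measurable C ->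
  iid P n [set t | C (pick a (tnth t), pick b (tnth t))] = (Qa \x Qb)%E C.
Proof.
move=> la lb ab.
pose phi (t : n.-tuple space) := (pick a (tnth t), pick b (tnth t)).
have mphi : measurable_fun setT phi := measurable_pick2 a b.
have iphi := isMeasurableFun.Build _ _ _ _ phi mphi.
pose phi' : {mfun n.-tuple space >-> (space * space)%type} := HB.pack phi iphi.
apply: (@eq_probability_box2 _ _ _ (distribution (iid P n) phi') (Qa \x Qb)%E).
move=> A B cA cB; transitivity (Qa (box A) * Qb (box B))%E; last first.
  by apply/esym/product_measure1E; exact: measurable_box.
rewrite /distribution /pushforward/=.
transitivity (iid P n
    [set t | forall l, (slice a A l `&` slice b B l) (tnth t l)]).
  congr (iid P n _).
  apply/seteqP; split=> t /=.
    move=> [At Bt] l; split=> j <-.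
      exact: (coord_event_eq (cA j) _ (At j)).
    exact: (coord_event_eq (cB j) _ (Bt j)).
  move=> ABt; split=> j /=.
    by have [/(_ j erefl) + _] := ABt (a j); exact: coord_event_eq.
  by have [_ /(_ j erefl)] := ABt (b j); exact: coord_event_eq.
transitivity (\prod_(l < n) P (slice a A l `&` slice b B l))%E.
  by apply: iid_box => l; apply: measurableI; exact: measurable_slice.
rewrite -(prod_slice la cA) -(prod_slice lb cB) -big_split/=.
apply: eq_bigr => l _; have [[j ajl]|al] := pselect (exists j, a j = l).
  have -> : slice b B l = setT by apply: slice_notin => i; rewrite -ajl eq_sym.
  by rewrite setIT probability_setT mule1.
have -> : slice a A l = setT.
  by apply: slice_notin => j; apply/eqP => ajl; apply: al; exists j.
by rewrite setTI probability_setT mul1e.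
Qed.

Lemma mean_pick2 a b Qa Qb (f : space * space -> R) :
  pick_law a Qa -> pick_law b Qb -> (forall i j, a i != b j) -> bmeas f ->
  \int[iid P n]_t f (pick a (tnth t), pick b (tnth t)) =
  \int[(Qa \x Qb)%E]_z f z.
Proof.
move=> la lb ab bf.
apply: (mean_distribution (measurable_pick2 a b)) => // C mC.
exact: pick_law2.
Qed.

End picks.

(** * Exchangeability and ranks of the Laplace noise *)

Lemma prob_mean_indic {disp} {T : measurableType disp} {R : realType}
    (P : probability T R) (A : set T) : measurable A ->
  bmeas (\1_A : T -> R) /\ P A = (\int[P]_x \1_A x)%:E.
Proof.
move=> mA; have bA : bmeas (\1_A : T -> R).
  by split; [exact: measurable_indic | exists 1 => x; rewrite indicE; case: (_ \in _);
    rewrite /= ?normr1 ?normr0].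
split=> //; rewrite -(expectation_mean P bA) unlock integral_indic// setIT//.
Qed.

Section exchangeability.
Context {disp : measure_display} {T : measurableType disp} {R : realType}.

Lemma eq_probability_tuple n (P Q : probability (n.-tuple T) R) :
  (forall B : 'I_n -> set T, (forall i, measurable (B i)) ->
     P [set t | forall i, B i (tnth t i)] = Q [set t | forall i, B i (tnth t i)]) ->
  forall A, measurable A -> P A = Q A.
Proof.
move=> PQ; pose G : set (set (n.-tuple T)) := [set A | exists2 B : 'I_n -> set T,
  forall i, measurable (B i) & A = [set t | forall i, B i (tnth t i)]].
apply: (@eq_probability_generated _ _ _ G).
- move=> _ _ [B mB ->] [C mC ->]; exists (fun i => B i `&` C i).
    by move=> i; exact: measurableI.
  apply/seteqP; split=> t /= => [[Bt Ct] i|BC]; first by split.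
  by split=> i; case: (BC i).
- by exists (fun=> setT) => //; apply/seteqP.
- move=> _ [B mB ->].
  rewrite (_ : [set _ | _] = \bigcap_(i in [set: 'I_n])
      ((fun t : n.-tuple T => tnth t i) @^-1` B i)).
    apply: fin_bigcap_measurable => // i _; rewrite -[X in measurable X]setTI.
    exact: (@measurable_tnth _ T n i).
  by apply/seteqP; split=> t /= Bt i => [_|]; exact: Bt.
- move=> A mA.
  (* the identity is measurable from <<s G>>, as every projection is *)
  have mid : measurable_fun setT (id : g_sigma_algebraType G -> n.-tuple T).
    apply/measurable_fun_tnthP => i _ C mC; rewrite setTI.
    apply: sub_sigma_algebra; exists (fun j => if j == i then C else setT).
      by move=> j; case: ifP.
    apply/seteqP; split=> t /= Ct; first by move=> j; case: eqP => [->|].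
    by have := Ct i; rewrite eqxx.
  by have := mid measurableT A mA; rewrite setTI.
- by move=> _ [B mB ->]; exact: PQ.
Qed.

Definition permute_tuple n (s : 'I_n -> 'I_n) (t : n.-tuple T) : n.-tuple T :=
  [tuple tnth t (s i) | i < n].

Lemma measurable_permute_tuple n (s : 'I_n -> 'I_n) :
  measurable_fun setT (permute_tuple s).
Proof.
apply/measurable_fun_tnthP => i.
rewrite (_ : _ \o _ = fun t => tnth t (s i)); first exact: measurable_tnth.
by apply/funext => t /=; rewrite tnth_mktuple.
Qed.

Lemma iid_exchangeable (P : probability T R) n (s : 'I_n -> 'I_n) :
  injective s -> forall A, measurable A ->
  iid P n (permute_tuple s @^-1` A) = iid P n A.
Proof.
move=> is_; have mphi := measurable_permute_tuple s.
have iphi := isMeasurableFun.Build _ _ _ _ (permute_tuple s) mphi.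
pose phi : {mfun n.-tuple T >-> n.-tuple T} := HB.pack (permute_tuple s) iphi.
apply: (@eq_probability_tuple _ (distribution (iid P n) phi)) => B mB.
have bs : bijective s := injF_bij is_.
case: (bs) => r sK rK.
transitivity (iid P n [set t | forall i, B (r i) (tnth t i)]).
  congr (iid P n _); apply/seteqP; split=> t /= Bt i.
    by have := Bt (r i); rewrite tnth_mktuple rK.
  by have := Bt (s i); rewrite tnth_mktuple sK.
transitivity (\prod_(i < n) P (B (r i)))%E; first exact: iid_box.
transitivity (\prod_(i < n) P (B i))%E; last by apply/esym; exact: iid_box.
by rewrite (reindex s)/=; [apply: eq_bigr => i _; rewrite sK | exact: onW_bij].
Qed.

End exchangeability.

Section laplace_ranks.
Context {R : realType}.
Local Notation lap := (@laplace_prob R).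

(** The density is at most [1]. *)
Lemma laplace_interval (a s : R) : 0 <= s ->
  (lap (`](a - s)%R, a]%classic : set R) <= s%:E)%E.
Proof.
move=> s0; rewrite /laplace_prob.
apply: (@le_trans _ _
  (\int[lebesgue_measure]_(x in (`](a - s)%R, a]%classic : set R)) 1%:E)%E).
  apply: ge0_le_integral => //.
  - by move=> x _; rewrite lee_fin laplace_pdf_ge0.
  - apply/measurable_EFinP; apply: measurable_funTS; exact: measurable_laplace_pdf.
  - move=> x _; rewrite lee_fin /laplace_pdf ler_pdivrMr// mul1r.
    by apply: (@le_trans _ _ 1); rewrite ?ler1n// -expR0 ler_expR oppr_le0.
apply: (@le_trans _ _ (lebesgue_measure (`](a - s)%R, a]%classic : set R))).
  by rewrite integral_cst// mul1e.
rewrite lebesgue_measure_itv/= lte_fin; case: ifP => _; last by rewrite lee_fin.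
by rewrite -EFinB lee_fin opprB addrC subrK.
Qed.

Variable B : nat.
Implicit Type t : B.+1.-tuple R.

Definition upper_rank t (c : 'I_B.+1) : R :=
  \sum_(b < B.+1) ((tnth t c <= tnth t b)%R : bool)%:R.

Definition top_set (alpha : R) (c : 'I_B.+1) : set (B.+1.-tuple R) :=
  [set t | upper_rank t c <= alpha * B.+1%:R].

Definition near_tie (s : R) (b : 'I_B) : set (B.+1.-tuple R) :=
  [set t | tnth t ord0 <= tnth t (lift ord0 b) < tnth t ord0 + s].

Lemma measurable_top_set alpha c : measurable (top_set alpha c).
Proof.
apply: measurable_ler_set => //.
apply: measurable_sum => b.
rewrite (_ : (fun _ => _) = \1_[set t | tnth t c <= tnth t b]); last first.
  apply/funext => t; rewrite indicE.
  rewrite (_ : (t \in _) = (tnth t c <= tnth t b))//.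
  by apply/idP/idP; rewrite inE.
apply: measurable_indic; apply: measurable_ler_set; exact: measurable_tnth.
Qed.

Lemma measurable_near_tie s b : measurable (near_tie s b).
Proof.
rewrite (_ : near_tie s b = [set t | tnth t ord0 <= tnth t (lift ord0 b)] `\`
    [set t | tnth t ord0 + s <= tnth t (lift ord0 b)]); last first.
  apply/seteqP; split=> t /=.
    by move=> /andP[h1 h2]; split=> //; apply/negP; rewrite -ltNge.
  by move=> [h1 /negP h2]; apply/andP; split=> //; rewrite ltNge.
apply: measurableD; apply: measurable_ler_set; try exact: measurable_tnth.
by apply: measurable_funD => //; exact: measurable_tnth.
Qed.

(** Among [B.+1] numbers, at most [m] are dominated by at most [m] of them, by
    looking at the smallest number with that property. *)
Lemma sum_top_set (alpha : R) t : 0 <= alpha ->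
  \sum_(c < B.+1) (\1_(top_set alpha c) t : R) <= alpha * B.+1%:R.
Proof.
move=> a0.
have -> : \sum_(c < B.+1) (\1_(top_set alpha c) t : R) =
    \sum_(c < B.+1 | upper_rank t c <= alpha * B.+1%:R) 1.
  rewrite [RHS]big_mkcond/=; apply: eq_bigr => c _; rewrite indicE.
  rewrite (_ : (t \in top_set alpha c) = (upper_rank t c <= alpha * B.+1%:R)).
    by case: ifP.
  by apply/idP/idP; rewrite inE.
have [c0 Sc0|S0] := pickP (fun c => upper_rank t c <= alpha * B.+1%:R); last first.
  by rewrite big_pred0// mulr_ge0.
case: (@arg_minP _ _ _ c0 (fun c => upper_rank t c <= alpha * B.+1%:R)
  (fun c => tnth t c) Sc0) => c Sc cmin.
apply: le_trans Sc; rewrite /upper_rank [leLHS]big_mkcond/=.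
by apply: ler_sum => b _; case: ifP => // /cmin ->.
Qed.

(** By exchangeability the events [top_set alpha c] are equiprobable, and
    [sum_top_set] bounds the sum of their indicators. *)
Lemma top_set_prob (alpha : R) : 0 <= alpha ->
  (iid lap B.+1 (top_set alpha ord0) <= alpha%:E)%E.
Proof.
move=> a0; set P := iid lap B.+1.
have b1 c : bmeas (\1_(top_set alpha c) : B.+1.-tuple R -> R).
  exact: (prob_mean_indic P (measurable_top_set alpha c)).1.
have PE c : P (top_set alpha c) = (\int[P]_t \1_(top_set alpha c) t)%:E.
  exact: (prob_mean_indic P (measurable_top_set alpha c)).2.
have Pc c : P (top_set alpha c) = P (top_set alpha ord0).
  have sI : injective (tperm ord0 c) := @perm_inj _ (tperm ord0 c).
  rewrite -(iid_exchangeable _ sI (measurable_top_set alpha ord0)).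
  congr (P _); apply/seteqP.
  have rE t : upper_rank (permute_tuple (tperm ord0 c) t) ord0 = upper_rank t c.
    rewrite /upper_rank [RHS](reindex_inj sI)/=; apply: eq_bigr => b _.
    by rewrite !tnth_mktuple tpermL.
  by split=> t /=; rewrite /top_set/= rE.
rewrite PE lee_fin -(@ler_pM2l _ B.+1%:R)//.
have -> : B.+1%:R * \int[P]_t \1_(top_set alpha ord0) t =
    \int[P]_t \sum_(c < B.+1) (\1_(top_set alpha c) t : R).
  rewrite mean_sum// (eq_bigr (fun=> \int[P]_t \1_(top_set alpha ord0) t)).
    by rewrite sumr_const card_ord mulr_natl.
  by move=> c _; apply: EFin_inj; rewrite -!PE.
rewrite -[leRHS](mean_cst P) [B.+1%:R * _]mulrC; apply: le_Rintegral => //.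
- by apply: bmeas_integrable; exact: bmeas_sum.
- by apply: bmeas_integrable; exact: bmeas_cst.
- by move=> t _; exact: sum_top_set.
Qed.

(** Given the entry [b + 1], entry [0] has to fall in an interval of length
    [s]. *)
Lemma near_tie_prob (s : R) b : 0 <= s ->
  (iid lap B.+1 (near_tie s b) <= s%:E)%E.
Proof.
move=> s0; pose P := iid lap B.
pose A : set (R * B.-tuple R) := [set z | near_tie s b (tuple_cons z)].
have mA : measurable A.
  rewrite -[A]setTI; exact: (measurable_tuple_cons _ (measurable_near_tie s b)).
have -> : iid lap B.+1 (near_tie s b) = (lap \x P)%E A by [].
have [bA ->] := prob_mean_indic (lap \x P)%E mA.
have [|bm ->] := mean_fubini_swap lap P bA; first by move=> z; rewrite indicE.
rewrite lee_fin -[leRHS](mean_cst P).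
have h (t : B.-tuple R) : \int[lap]_z \1_A (z, t) <= s.
  rewrite -lee_fin.
  have bz : bmeas (fun z : R => (\1_A (z, t) : R)).
    exact: (bmeas_comp (measurable_pair2 t) bA).
  rewrite -(expectation_mean _ bz) unlock.
  apply: le_trans (laplace_interval (tnth t b) s0).
  apply: integral_le_prob; first exact: measurable_itv.
  move=> z; rewrite !indicE ler0n/= ler_nat.
  case: (boolP ((z, t) \in A)) => // /[!inE] /=.
  rewrite /A /near_tie/= /tuple_cons tnth0 tnthS /= => /andP[h1 h2].
  by rewrite mem_set//= in_itv/= h1 andbT ltrBlDr.
apply: le_Rintegral => //; first exact: bmeas_integrable.
by apply: bmeas_integrable; exact: bmeas_cst.
Qed.

Definition bad_noise (alpha s : R) : set (B.+1.-tuple R) :=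
  top_set alpha ord0 `|` \big[setU/set0]_(b < B) near_tie s b.

Lemma bad_noise_prob (alpha s : R) : 0 <= alpha -> 0 <= s ->
  measurable (bad_noise alpha s) /\
  (iid lap B.+1 (bad_noise alpha s) <= (alpha + B%:R * s)%:E)%E.
Proof.
move=> a0 s0; have mtop := measurable_top_set alpha ord0.
have [mt pt] : measurable (\big[setU/set0]_(b < B) near_tie s b) /\
    (iid lap B.+1 (\big[setU/set0]_(b < B) near_tie s b) <= (B%:R * s)%:E)%E.
  rewrite mulr_natl -[in X in (_ <= X)%E](card_ord B) -sumr_const.
  elim/big_rec2: _ => [|b e A _ [mA pA]].
    by rewrite measure0; split; first exact: measurable0.
  have mb := measurable_near_tie s b.
  split; first exact: measurableU.
  apply: le_trans (measureU2 _ mb mA) _.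
  by rewrite EFinD leeD// near_tie_prob.
split; first exact: measurableU.
apply: le_trans (measureU2 _ mtop mt) _.
by rewrite EFinD leeD// top_set_prob.
Qed.

(** Without a near tie, the entries above entry [0] exceed it by at least [s]. *)
Lemma bad_noiseP (alpha s : R) t :
  1 + \sum_(b < B) ((tnth t ord0 + s <= tnth t (lift ord0 b))%R : bool)%:R
    <= alpha * B.+1%:R -> bad_noise alpha s t.
Proof.
move=> ht; have [[b tb]|nt] := pselect (exists b, near_tie s b t).
  by right; rewrite (bigD1 b)//=; left.
left; rewrite /top_set/=; apply: le_trans ht.
rewrite /upper_rank big_ord_recl lexx lerD2l; apply: ler_sum => b _.
rewrite ler_nat; case: (boolP (tnth t ord0 <= _)) => // tb.
case: (leP (_ + s)) => // st; case: nt; exists b.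
by rewrite /near_tie/= tb st.
Qed.

End laplace_ranks.

(** * Reproducing kernel Hilbert spaces *)

Section rkhs_theory.
Context {R : realType} {T : Type} {k : T -> T -> R}.
Variable H : rkhs k.
Implicit Types f g : T -> R.
Local Notation ip := (rkhs_ip H).
Local Notation inH := (rkhs_set H).

Lemma rkhs_setZ (c : R) f : inH f -> inH (fun x => c * f x).
Proof.
move=> Hf; have := rkhs_setD c Hf (rkhs_set0 H).
by rewrite (_ : (fun x => _) = fun x => c * f x)//; apply/funext => x; rewrite addr0.
Qed.

Lemma rkhs_ip0l g : inH g -> ip (fun=> 0) g = 0.
Proof.
move=> Hg; have H0 := rkhs_set0 H; have := rkhs_ipD 1 H0 H0 Hg.
rewrite (_ : (fun x => _) = fun=> 0); last by apply/funext => x; rewrite mul1r addr0.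
by move=> /eqP; rewrite mul1r -subr_eq0 opprD addNKr oppr_eq0 => /eqP.
Qed.

Lemma rkhs_ipZ (c : R) f g : inH f -> inH g -> ip (fun x => c * f x) g = c * ip f g.
Proof.
move=> Hf Hg; have := rkhs_ipD c Hf (rkhs_set0 H) Hg.
rewrite (_ : (fun x => _) = fun x => c * f x); last first.
  by apply/funext => x; rewrite addr0.
by rewrite rkhs_ip0l// addr0.
Qed.

Lemma rkhs_ipE (c e : R) f g : inH f -> inH g ->
  ip (fun x => c * f x + e * g x) (fun x => c * f x + e * g x) =
  c ^+ 2 * ip f f + 2 * c * e * ip f g + e ^+ 2 * ip g g.
Proof.
move=> Hf Hg; have Heg := rkhs_setZ e Hg.
have Hm := rkhs_setD c Hf Heg.
rewrite rkhs_ipD// rkhs_ipZ// (rkhs_ipC Hf Hm) (rkhs_ipC Hg Hm).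
rewrite !rkhs_ipD// !rkhs_ipZ// (rkhs_ipC Hg Hf); ring.
Qed.

Lemma rkhs_CauchySchwarz f g : inH f -> inH g ->
  ip f g ^+ 2 <= ip f f * ip g g.
Proof.
move=> Hf Hg.
have q (c e : R) : 0 <= c ^+ 2 * ip f f + 2 * c * e * ip f g + e ^+ 2 * ip g g.
  rewrite -rkhs_ipE//; apply: rkhs_ip_ge0; apply: rkhs_setD => //.
  exact: rkhs_setZ.
have [g0|gN0] := eqVneq (ip g g) 0.
  rewrite g0 mulr0.
  have -> : ip f g = 0; last by rewrite expr0n.
  (* an affine function of a real parameter that stays nonnegative is constant *)
  apply/eqP; apply: contraTT isT => fg0.
  have := q 1 (- (ip f f + 1) / (2 * ip f g)); rewrite g0.
  have -> : 1 ^+ 2 * ip f f +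
     2 * 1 * (- (ip f f + 1) / (2 * ip f g)) * ip f g +
     (- (ip f f + 1) / (2 * ip f g)) ^+ 2 * 0 = -1 by field.
  by lra.
have g0 : 0 < ip g g by rewrite lt_neqAle eq_sym gN0 rkhs_ip_ge0.
have := q 1 (- ip f g / ip g g).
have -> : 1 ^+ 2 * ip f f + 2 * 1 * (- ip f g / ip g g) * ip f g +
    (- ip f g / ip g g) ^+ 2 * ip g g = ip f f - ip f g ^+ 2 / ip g g by field.
by rewrite subr_ge0 ler_pdivrMr.
Qed.

Lemma rkhs_kernel_ip x y : ip (k x) (k y) = k x y.
Proof. by rewrite rkhs_reproducing//; exact: rkhs_kernel. Qed.

Lemma rkhs_kernelC x y : k x y = k y x.
Proof. by rewrite -rkhs_kernel_ip rkhs_ipC ?rkhs_kernel_ip//; exact: rkhs_kernel. Qed.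

Lemma rkhs_eval_le f x : inH f -> f x ^+ 2 <= ip f f * k x x.
Proof.
move=> Hf; rewrite -(rkhs_reproducing x Hf) -rkhs_kernel_ip.
by apply: rkhs_CauchySchwarz => //; exact: rkhs_kernel.
Qed.

Lemma rkhs_eval_dist f x y : inH f ->
  (f x - f y) ^+ 2 <= ip f f * (k x x - 2 * k x y + k y y).
Proof.
move=> Hf; have Hx := rkhs_kernel H x; have Hy := rkhs_kernel H y.
have Hxy : inH (fun z => 1 * k x z + (-1) * k y z).
  by apply: rkhs_setD => //; exact: rkhs_setZ.
have := rkhs_CauchySchwarz Hxy Hf; rewrite rkhs_ipE// rkhs_ipD//; last first.
  exact: rkhs_setZ.
rewrite rkhs_ipZ// !(rkhs_ipC (rkhs_kernel H _) Hf) !rkhs_reproducing//.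
set u := ip f f; rewrite (_ : 1 * f x + -1 * f y = f x - f y); last by ring.
by move/le_trans; apply; rewrite le_eqVlt; apply/orP; left; apply/eqP; ring.
Qed.

Definition kernel_sum (I : finType) (c : R) (z : I -> T) : T -> R :=
  fun x => c * \sum_i k (z i) x.

Lemma kernel_sum_set_ip (I : finType) (c : R) (z : I -> T) :
  inH (kernel_sum c z) /\
  forall g, inH g -> ip (kernel_sum c z) g = c * \sum_i g (z i).
Proof.
suff Hs (s : seq I) : inH (fun x => \sum_(i <- s) k (z i) x) /\
    forall g, inH g ->
      ip (fun x => \sum_(i <- s) k (z i) x) g = \sum_(i <- s) g (z i).
  have [Hi ipi] := Hs (index_enum I).
  by split; [exact: rkhs_setZ | move=> g Hg; rewrite rkhs_ipZ// ipi].
elim: s => [|i s [Hs ips]].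
  have -> : (fun x => \sum_(i <- [::]) k (z i) x) = fun=> 0.
    by apply/funext => x; rewrite big_nil.
  by split=> [|g Hg]; [exact: rkhs_set0 | rewrite big_nil rkhs_ip0l].
have -> : (fun x => \sum_(j <- i :: s) k (z j) x) =
    fun x => 1 * k (z i) x + \sum_(j <- s) k (z j) x.
  by apply/funext => x; rewrite big_cons mul1r.
have Hi := rkhs_kernel H (z i).
split=> [|g Hg]; first exact: rkhs_setD.
by rewrite rkhs_ipD// ips// big_cons mul1r (rkhs_ipC Hi Hg) rkhs_reproducing.
Qed.

(** The squared norm of [kernel_sum c z - kernel_sum e w]. *)
Definition embedding_gap (I J : finType) (c e : R) (z : I -> T) (w : J -> T) : R :=
  c ^+ 2 * (\sum_i \sum_i' k (z i) (z i'))
  + e ^+ 2 * (\sum_j \sum_j' k (w j) (w j'))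
  - 2 * (c * e) * (\sum_i \sum_j k (z i) (w j)).

(** The second bound is the Cauchy-Schwarz inequality against [g]. *)
Lemma embedding_gap_ge0 (I J : finType) (c e : R) (z : I -> T) (w : J -> T) :
  0 <= embedding_gap c e z w /\
  forall g, inH g -> (c * \sum_i g (z i) - e * \sum_j g (w j)) ^+ 2 <=
    ip g g * embedding_gap c e z w.
Proof.
have [Hz ipz] := kernel_sum_set_ip c z; have [Hw ipw] := kernel_sum_set_ip e w.
pose m x := 1 * kernel_sum c z x + (-1) * kernel_sum e w x.
have Hm : inH m by apply: rkhs_setD => //; exact: rkhs_setZ.
have mE : ip m m = embedding_gap c e z w.
  rewrite rkhs_ipE// !ipz// !ipw// /embedding_gap /kernel_sum.
  rewrite -!big_distrr/= [X in c * (c * X)]exchange_big/=.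
  rewrite [X in e * (e * X)]exchange_big/=.
  under [X in c * (e * X)]eq_bigr do under eq_bigr do rewrite rkhs_kernelC.
  ring.
split; first by rewrite -mE; exact: rkhs_ip_ge0.
move=> g Hg; have := rkhs_CauchySchwarz Hm Hg; rewrite mE mulrC.
rewrite rkhs_ipD//; last exact: rkhs_setZ.
by rewrite (rkhs_ipZ (-1) Hw)// ipz// ipw// mul1r mulN1r [ip g g * _]mulrC.
Qed.

End rkhs_theory.

(** * The product kernel: bounds and measurability *)

(** The set where [phi] exceeds [a] is a countable union of balls centred at the
    points [q l]. *)
Lemma measurable_lipschitz {disp} {T : measurableType disp} {R : realType}
    (phi : T -> R) (s : T -> T -> R) (q : nat -> T) :
  (forall l, measurable_fun setT (fun x => s x (q l))) ->
  (forall x e, 0 < e -> exists l, s x (q l) < e) ->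
  (forall x y, `|phi x - phi y| <= s x y) ->
  measurable_fun setT phi.
Proof.
move=> ms qd lip; apply: (measurability _ (RGenOInfty.measurableE R)).
move=> _ [_ [a ->] <-]; rewrite setTI.
rewrite (_ : _ @^-1` _ =
    \bigcup_l [set x | s x (q l) < phi (q l) - a]); last first.
  apply/seteqP; split=> x /=; rewrite in_itv/= andbT => ax.
    have [|l sl] := qd x ((phi x - a) / 2); first by lra.
    by exists l => //=; have := lip x (q l); rewrite ler_norml; lra.
  by case: ax => l _ /= sl; have := lip x (q l); rewrite ler_norml; lra.
apply: bigcupT_measurable => l.
have := ms l measurableT `]-oo, phi (q l) - a[%classic (measurable_itv _).
by rewrite setTI; congr (measurable _).
Qed.

(** Factors close to their maxima give a product close to its maximum. *)
Lemma prod_lower_bound {R : realType} (I : Type) (s : seq I) (K : I -> R) :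
  (forall i, 0 <= K i) ->
  exists2 C : R, 0 <= C & forall (eta : R) (a : I -> R), 0 <= eta ->
    (forall i, 0 <= a i <= K i) -> (forall i, K i - a i <= eta) ->
    \prod_(i <- s) K i - \prod_(i <- s) a i <= eta * C.
Proof.
move=> K0; elim: s => [|i s [C C0 IH]].
  by exists 0 => // eta a _ _ _; rewrite !big_nil subrr mulr0.
exists (\prod_(j <- s) K j + K i * C) => [|eta a eta0 aK Ka].
  by rewrite addr_ge0 ?mulr_ge0// prodr_ge0.
rewrite !big_cons; have := IH eta a eta0 aK Ka.
have : 0 <= \prod_(j <- s) K j by rewrite prodr_ge0.
have /andP[] := aK i; have := Ka i.
set P := \prod_(j <- s) K j; set A := \prod_(j <- s) a j => h1 h2 h3 h4 h5.
have -> : K i * P - a i * A = (K i - a i) * P + a i * (P - A) by ring.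
rewrite [leRHS]mulrDr lerD// ?ler_wpM2r//.
apply: le_trans (_ : a i * (eta * C) <= _); first exact: ler_wpM2l.
by rewrite mulrCA ler_wpM2l// ler_wpM2r.
Qed.

Section product_kernel.
Context {R : realType} {d : nat} {X : 'I_d -> diffSpace}.
Variables (k : forall j, X j -> X j -> R) (Kj : 'I_d -> R).
Hypothesis X_separable : forall j, separable_space (X j).
Hypothesis k_continuous : forall j,
  continuous (fun z : X j * X j => k z.1 z.2).
Hypothesis k_diag : forall j (x : X j), k x x = Kj j.
Hypothesis k_bounded : forall j (x y : X j), 0 <= k x y <= Kj j.
Variable H : rkhs (prod_kernel k).
Local Notation space := (prodspace X).
Local Notation pk := (prod_kernel k).
Local Notation K := (\prod_(j < d) Kj j).

Lemma Kj_ge0 j : 0 <= Kj j.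
Proof.
by case/andP: (k_bounded (0 : X j) 0) => h1 h2; exact: le_trans h2.
Qed.

Lemma pk_diag x : pk x x = K.
Proof. by apply: eq_bigr => j _; exact: k_diag. Qed.

Lemma pk_ge0 x y : 0 <= pk x y.
Proof. by apply: prodr_ge0 => j _; case/andP: (k_bounded (x j) (y j)). Qed.

Lemma pk_le x y : pk x y <= K.
Proof. by apply: ler_prod => j _; exact: k_bounded. Qed.

Lemma K_ge0 : 0 <= K.
Proof. by apply: prodr_ge0 => j _; exact: Kj_ge0. Qed.

Lemma measurable_pk_section (q : space) : measurable_fun setT (pk^~ q).
Proof.
have mj j : measurable_fun setT (fun x : space => k (x j) (q j)).
  apply: (measurability _ (RGenOInfty.measurableE R)).
  move=> _ [_ [a ->] <-]; rewrite setTI; apply: sub_sigma_algebra.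
  exists j, [set u : X j | a < k u (q j)]; split; last first.
    by apply/seteqP; split=> x /=; rewrite in_itv/= andbT.
  apply: sub_sigma_algebra => /=.
  have cu : continuous (fun u : X j => k u (q j)).
    move=> u; have := @k_continuous j (u, q j).
    apply: (@continuous_comp _ _ _ (fun v : X j => (v, q j))
      (fun z : X j * X j => k z.1 z.2)).
    by apply: cvg_pair => //=; exact: cvg_cst.
  exact: ((continuousP _).1 cu [set u | a < u] (@open_gt R a)).
rewrite /prod_kernel; apply: measurable_prod => j _; exact: mj.
Qed.

(** Separability for the distance [sqrt (2 * (K - pk x y))] between the features
    of [x] and [y] in the Hilbert space: by continuity of the kernels, dense
    sequences of the factors are dense for this distance. *)
Lemma space_dense_sequence : exists q : nat -> space,
  forall x (e : R), 0 < e -> exists l, K - pk x (q l) < e.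
Proof.
have seqj j : exists u : nat -> X j,
    forall x (e : R), 0 < e -> exists l, Kj j - k x (u l) < e.
  have [D cD dD] := X_separable j.
  have [y0 Dy0] : exists y, D y.
    have [y [_ Dy]] := dD setT (ex_intro _ (0 : X j) I) openT; by exists y.
  have [u Du] : exists u : nat -> X j, forall y, D y -> exists l, u l = y.
    have /countable_injP[g gI] := cD.
    exists (fun l => xget y0 [set y | D y /\ g y = l]) => y Dy; exists (g y).
    have [|Dx gxy] := @xgetPex _ y0 [set x | D x /\ g x = g y]; first by exists y.
    by apply: gI; rewrite ?inE.
  exists u => x e e0.
  pose U := [set y : X j | Kj j - e < k x y].
  have oU : open U.
    have cu : continuous (fun y : X j => k x y).
      move=> y; have := @k_continuous j (x, y).
      apply: (@continuous_comp _ _ _ (fun v : X j => (x, v))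
        (fun z : X j * X j => k z.1 z.2)).
      by apply: cvg_pair => //=; exact: cvg_cst.
    exact: ((continuousP _).1 cu [set u | Kj j - e < u] (@open_gt R _)).
  have Ux : U x by rewrite /U/= k_diag; lra.
  have [y [Uy /Du[l uly]]] := dD U (ex_intro _ x Ux) oU.
  by exists l; rewrite uly; move: Uy; rewrite /U/=; lra.
pose u j := projT1 (cid (seqj j)).
have uP j : forall x (e : R), 0 < e -> exists l, Kj j - k x (u j l) < e.
  exact: projT2 (cid (seqj j)).
pose q (l : nat) : space := fun j =>
  if unpickle l is Some g then u j ((g : {ffun 'I_d -> nat}) j) else 0.
exists q => x e e0.
have [C C0 hC] := prod_lower_bound (index_enum 'I_d) Kj_ge0.
have eC : 0 < e / (C + 1) by rewrite divr_gt0//; lra.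
have /choice[g gP] : forall j, exists l, Kj j - k (x j) (u j l) < e / (C + 1).
  by move=> j; exact: uP.
exists (pickle [ffun j => g j]); rewrite /q.
apply: le_lt_trans (hC (e / (C + 1)) _ (ltW eC) _ _) _.
- by move=> j; exact: k_bounded.
- by move=> j; rewrite pickleK ffunE ltW.
- by rewrite -mulrA gtr_pMr// mulrC ltr_pdivrMr ?mul1r; lra.
Qed.

Lemma dense_sequence_small (c : R) (q : nat -> space) :
  (forall x (e : R), 0 < e -> exists l, K - pk x (q l) < e) -> 0 <= c ->
  forall x e, 0 < e -> exists l, c * Num.sqrt (2 * (K - pk x (q l))) < e.
Proof.
move=> qd c0 x e e0.
have e1 : 0 < e / (c + 1) by rewrite divr_gt0//; lra.
have [|l hl] := qd x ((e / (c + 1)) ^+ 2 / 2).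
  by rewrite divr_gt0// exprn_gt0.
exists l; apply: (@le_lt_trans _ _ (c * (e / (c + 1)))); last first.
  by rewrite mulrCA gtr_pMr// ltr_pdivrMr ?mul1r; lra.
rewrite ler_wpM2l// -[leRHS]gtr0_norm// -sqrtr_sqr ler_wsqrtr//.
by move: hl; rewrite ltr_pdivlMr//; lra.
Qed.

Lemma measurable_dist_section (c : R) (q : space) :
  measurable_fun setT (fun x => c * Num.sqrt (2 * (K - pk x q))).
Proof.
apply: measurable_funM => //.
apply: (measurableT_comp (f := @Num.sqrt R)).
  exact: continuous_measurable_fun (@sqrt_continuous R).
apply: measurable_funM => //; apply: measurable_funB => //.
exact: measurable_pk_section.
Qed.

Lemma normr_le_sqrt (a b c : R) : 0 <= b -> 0 <= c -> a ^+ 2 <= b ^+ 2 * c ->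
  `|a| <= b * Num.sqrt c.
Proof.
move=> b0 c0 h; rewrite -sqrtr_sqr -[X in X * _](ger0_norm b0) -sqrtr_sqr.
by rewrite -sqrtrM ?sqr_ge0// ler_wsqrtr.
Qed.

Lemma rkhs_dist_le f x y : rkhs_set H f ->
  `|f x - f y| <= rkhs_norm H f * Num.sqrt (2 * (K - pk x y)).
Proof.
move=> Hf; apply: normr_le_sqrt; rewrite ?sqrtr_ge0//.
  by rewrite mulr_ge0// subr_ge0 pk_le.
rewrite /rkhs_norm sqr_sqrtr ?rkhs_ip_ge0//.
apply: le_trans (rkhs_eval_dist x y Hf) _.
by rewrite !pk_diag le_eqVlt; apply/orP; left; apply/eqP; ring.
Qed.

Lemma rkhs_bmeas f : rkhs_set H f -> bmeas f.
Proof.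
move=> Hf; split.
  have [q qd] := space_dense_sequence.
  apply: (@measurable_lipschitz _ _ _ _
    (fun x y => rkhs_norm H f * Num.sqrt (2 * (K - pk x y))) q).
  - by move=> l; exact: measurable_dist_section.
  - by apply: dense_sequence_small => //; exact: sqrtr_ge0.
  - by move=> x y; exact: rkhs_dist_le.
exists (rkhs_norm H f * Num.sqrt K) => x.
apply: normr_le_sqrt; rewrite ?sqrtr_ge0 ?K_ge0//.
by rewrite /rkhs_norm sqr_sqrtr ?rkhs_ip_ge0// -(pk_diag x) rkhs_eval_le.
Qed.

Lemma pk_dist_le x y z : `|pk x z - pk y z| <=
  Num.sqrt K * Num.sqrt (2 * (K - pk x y)).
Proof.
rewrite !(rkhs_kernelC H _ z).
have := rkhs_dist_le x y (rkhs_kernel H z).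
by rewrite /rkhs_norm rkhs_kernel_ip pk_diag.
Qed.

(** A continuous function on [X j * X j] may fail to be measurable for the product
    of the Borel sigma-algebras; the kernel is, being Lipschitz in each argument
    for the separable feature distance. *)
Lemma pk_bmeas : bmeas (fun z : space * space => pk z.1 z.2).
Proof.
split; last by exists K => z; rewrite ger0_norm ?pk_ge0// pk_le.
have [q qd] := space_dense_sequence.
pose s x y := Num.sqrt K * Num.sqrt (2 * (K - pk x y)).
pose q2 l := if unpickle l is Some (l1, l2) then (q l1, q l2) else (q 0, q 0).
apply: (@measurable_lipschitz _ _ _ _ (fun x y => s x.1 y.1 + s x.2 y.2) q2).
- move=> l; apply: measurable_funD.
    exact: (measurableT_comp (measurable_dist_section _ _) measurable_fst).
  exact: (measurableT_comp (measurable_dist_section _ _) measurable_snd).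
- move=> x e e0; have e2 : 0 < e / 2 by rewrite divr_gt0.
  have [l1 h1] := dense_sequence_small qd (sqrtr_ge0 K) x.1 e2.
  have [l2 h2] := dense_sequence_small qd (sqrtr_ge0 K) x.2 e2.
  exists (pickle (l1, l2)); rewrite /q2 pickleK /= /s.
  by rewrite [ltRHS]splitr ltrD.
- move=> x y; rewrite (_ : _ - _ = (pk x.1 x.2 - pk y.1 x.2)
    + (pk x.2 y.1 - pk y.2 y.1)); last first.
    by rewrite (rkhs_kernelC H x.2) (rkhs_kernelC H y.2); ring.
  by apply: le_trans (ler_normD _ _) _; rewrite lerD// pk_dist_le.
Qed.

End product_kernel.

(** * U-statistic and V-statistic *)

Section tuple_averages.
Context {R : realType} (n : nat).

(** Average of [h] over the [m]-tuples without repetition. *)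
Definition inj_avg (m : nat) (h : {ffun 'I_m -> 'I_n} -> R) : R :=
  (n - m)`!%:R / n`!%:R * \sum_(i : {ffun 'I_m -> 'I_n} | injectiveb i) h i.

Definition tuple_avg (m : nat) (h : {ffun 'I_m -> 'I_n} -> R) : R :=
  n%:R^-1 ^+ m * \sum_i h i.

Lemma inj_avgE (m : nat) (h : {ffun 'I_m -> 'I_n} -> R) : (m <= n)%N ->
  inj_avg h = (\sum_(i : {ffun 'I_m -> 'I_n} | injectiveb i) h i) / (n ^_ m)%:R.
Proof.
move=> mn; rewrite /inj_avg mulrC; congr (_ * _).
by rewrite -(ffact_fact mn) natrM invfM mulrCA divff ?mulr1//.
Qed.

Lemma card_injective_ffun (m : nat) :
  (\sum_(i : {ffun 'I_m -> 'I_n} | injectiveb i) (1 : R)) = (n ^_ m)%:R.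
Proof.
by rewrite sumr_const -[#|_|]cardsE card_inj_ffuns !card_ord.
Qed.

Lemma inj_avg_cst (m : nat) (h : {ffun 'I_m -> 'I_n} -> R) (c : R) :
  (m <= n)%N -> (forall i : {ffun 'I_m -> 'I_n}, injectiveb i -> h i = c) ->
  inj_avg h = c.
Proof.
move=> mn hc; rewrite inj_avgE// (eq_bigr (fun=> c * 1)); last first.
  by move=> i /hc ->; rewrite mulr1.
rewrite -big_distrr/= card_injective_ffun mulfK//.
by rewrite pnatr_eq0 -lt0n ffact_gt0.
Qed.

(** The difference is the probability that [m] draws with replacement
    contain a repetition. *)
Lemma ffact_ratio (m : nat) : (m <= n)%N -> (0 < n)%N ->
  0 <= 1 - (n ^_ m)%:R / (n%:R : R) ^+ m <= m%:R ^+ 2 / n%:R.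
Proof.
move=> + n0; have nR : 0 < n%:R :> R by rewrite ltr0n.
elim: m => [_|m IH mn]; first by rewrite ffactn0 expr0 divr1 subrr expr0n mul0r lexx.
have := IH (ltnW mn); set q := _ / n%:R ^+ m => /andP[q1 qm].
have q0 : 0 <= q by rewrite divr_ge0// exprn_ge0.
have qE : (n ^_ m.+1)%:R / n%:R ^+ m.+1 = q * (1 - m%:R / n%:R) :> R.
  rewrite /q ffactnSr natrM natrB; last exact: ltnW.
  by rewrite exprSr; field; rewrite ?expf_neq0// ?gt_eqF.
have mnR : 0 <= m%:R / (n%:R : R) <= 1.
  by rewrite divr_ge0//= ler_pdivrMr// mul1r ler_nat ltnW.
rewrite qE; apply/andP; split; first by move/andP: mnR => []; nra.
apply: (@le_trans _ _ (m%:R ^+ 2 / n%:R + m%:R / n%:R)).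
  by move/andP: mnR => []; nra.
rewrite -mulrDl ler_wpM2r ?invr_ge0 ?ltW// -natr1.
by have : 0 <= m%:R :> R by []; nra.
Qed.

(** The two averages differ at most by [K] times the probability of a
    repetition. *)
Lemma inj_avg_approx (m : nat) (h : {ffun 'I_m -> 'I_n} -> R) (K : R) :
  (m <= n)%N -> (0 < n)%N -> (forall i, 0 <= h i <= K) ->
  `|inj_avg h - tuple_avg h| <= K * (m%:R ^+ 2 / n%:R).
Proof.
move=> mn n0 hK; have nR : 0 < n%:R :> R by rewrite ltr0n.
have /andP[r1 rm] := ffact_ratio mn n0.
have N0 : 0 < n%:R ^+ m :> R by rewrite exprn_gt0.
have Ni0 : 0 < (n ^_ m)%:R :> R by rewrite ltr0n ffact_gt0.
rewrite inj_avgE// /tuple_avg.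
rewrite [X in _ - _ * X](bigID (fun i : {ffun 'I_m -> 'I_n} => injectiveb i))/=.
set S := \sum_(i : {ffun 'I_m -> 'I_n} | injectiveb i) h i.
set S' := \sum_(i : {ffun 'I_m -> 'I_n} | ~~ injectiveb i) h i.
have S0 : 0 <= S by apply: sumr_ge0 => i _; case/andP: (hK i).
have S'0 : 0 <= S' by apply: sumr_ge0 => i _; case/andP: (hK i).
have SK : S <= K * (n ^_ m)%:R.
  rewrite -card_injective_ffun big_distrr/=; apply: ler_sum => i _.
  by rewrite mulr1; case/andP: (hK i).
have S'K : S' <= K * (n%:R ^+ m - (n ^_ m)%:R).
  have -> : n%:R ^+ m - (n ^_ m)%:R =
      \sum_(i : {ffun 'I_m -> 'I_n} | ~~ injectiveb i) (1 : R).
    apply/eqP; rewrite subr_eq addrC -card_injective_ffun.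
    have <- := bigID (fun i : {ffun 'I_m -> 'I_n} => injectiveb i) xpredT
      (fun=> 1 : R) (r := index_enum _) (op := +%R) (idx := 0).
    by rewrite sumr_const card_ffun !card_ord natrX.
  rewrite big_distrr/=; apply: ler_sum => i _.
  by rewrite mulr1; case/andP: (hK i).
move: r1 rm; set r := 1 - _ => r1 rm.
have K0 : 0 <= K.
  by rewrite -(pmulr_lge0 _ Ni0); exact: le_trans S0 SK.
apply: (@le_trans _ _ (K * r)); last exact: ler_wpM2l.
rewrite exprVn.
have -> : S / (n ^_ m)%:R - n%:R ^- m * (S + S') =
    S / (n ^_ m)%:R * r - S' / n%:R ^+ m.
  by rewrite /r; field; rewrite !gt_eqF.
have h1 : 0 <= S / (n ^_ m)%:R * r <= K * r.
  rewrite mulr_ge0 ?divr_ge0 ?(ltW Ni0)//=.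
  by rewrite ler_wpM2r// ler_pdivrMr.
have h2 : 0 <= S' / n%:R ^+ m <= K * r.
  rewrite divr_ge0 ?(ltW N0)//= ler_pdivrMr// (le_trans S'K)//.
  rewrite le_eqVlt; apply/orP; left; apply/eqP.
  by rewrite /r; field; rewrite gt_eqF.
by rewrite ler_norml; move/andP: h1 => [? ?]; move/andP: h2 => [? ?]; lra.
Qed.

End tuple_averages.

(** A function on a disjoint union is a pair of functions. *)
Lemma sum_ffun_split {V : nmodType} (I J L T : finType) (h : J + L -> I)
    (F : {ffun J -> T} -> {ffun L -> T} -> V) : bijective h ->
  \sum_(f : {ffun I -> T}) F [ffun j => f (h (inl j))] [ffun l => f (h (inr l))] =
  \sum_a \sum_b F a b.
Proof.
move=> [g hK gK]; rewrite pair_big/=.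
rewrite (reindex (fun ab : {ffun J -> T} * {ffun L -> T} => [ffun i =>
  match g i with inl j => ab.1 j | inr l => ab.2 l end])) /=; last first.
  exists (fun f => ([ffun j => f (h (inl j))], [ffun l => f (h (inr l))])).
    move=> [a b] _; congr pair; apply/ffunP => j; rewrite !ffunE hK//.
  move=> f _; apply/ffunP => i; rewrite !ffunE /=.
  by case E : (g i) => [j|l]; rewrite ffunE -E gK.
apply: eq_bigr => -[a b] _ /=.
by congr F; apply/ffunP => j; rewrite !ffunE hK.
Qed.

Lemma sum_ffun_unit {V : nmodType} (T : finType) (F : T -> V) :
  \sum_(a : {ffun unit -> T}) F (a tt) = \sum_t F t.
Proof.
rewrite (reindex (fun t => [ffun _ : unit => t])) /=; last first.
  exists (fun a => a tt) => [t|a] _; first by rewrite ffunE.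
  by apply/ffunP => -[]; rewrite ffunE.
by apply: eq_bigr => t _; rewrite ffunE.
Qed.

Lemma sample_size_bounds (d n : nat) : (2 <= d)%N -> (2 * d <= n)%N ->
  [/\ (0 < n)%N, (2 <= n)%N & (d.+1 <= n)%N].
Proof.
move=> d2 dn; have n2 : (2 <= n)%N := leq_trans (leq_pmulr 2 (ltnW d2)) dn.
split=> //; first exact: ltnW.
by rewrite (leq_trans _ dn)// mul2n -addnn -[d.+1]addn1 leq_add2l ltnW.
Qed.

(** [4], [(2d)^2] and [(d+1)^2] bound [n] times the probabilities of a repetition in
    tuples of lengths [2], [2d] and [d+1]. *)
Definition UV_const {R : realType} (d : nat) (K : R) : R :=
  K * (4 + (2 * d)%:R ^+ 2 + 2 * d.+1%:R ^+ 2).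

Section statistics.
Context {R : realType} {d : nat} {X : 'I_d -> diffSpace}.
Variables (k : forall j, X j -> X j -> R) (n : nat).
Local Notation space := (prodspace X).
Local Notation pk := (prod_kernel k).
Implicit Type x : 'I_n -> space.

Definition term1 x (i : {ffun 'I_2 -> 'I_n}) : R :=
  pk (x (i ord0)) (x (i ord_max)).
Definition term2 x (i : {ffun 'I_(2 * d) -> 'I_n}) : R :=
  pk (pick (fun j => i (pair_index j false)) x)
     (pick (fun j => i (pair_index j true)) x).
Definition term3 x (i : {ffun 'I_d.+1 -> 'I_n}) : R :=
  pk (x (i ord0)) (pick (fun j => i (lift ord0 j)) x).

Lemma U_dHSICE x : U_dHSIC k x =
  inj_avg (term1 x) + inj_avg (term2 x) - 2 * inj_avg (term3 x).
Proof. by rewrite /U_dHSIC /inj_avg !mulrA -subnDA addn1. Qed.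

(** The V-statistic: the squared RKHS distance between the embeddings of the
    empirical law and of the product of the empirical marginals. *)
Definition V_dHSIC x : R :=
  embedding_gap (k := pk) n%:R^-1 (n%:R^-1 ^+ d) x
    (fun a : {ffun 'I_d -> 'I_n} => pick a x).

Lemma V_dHSICE x : V_dHSIC x =
  tuple_avg (term1 x) + tuple_avg (term2 x) - 2 * tuple_avg (term3 x).
Proof.
rewrite /V_dHSIC /embedding_gap /tuple_avg; congr (_ + _ - _).
- congr (_ * _).
  pose h (u : unit + unit) : 'I_2 := if u is inl _ then ord0 else ord_max.
  have bh : bijective h.
    by apply: inj_card_bij; [case=> -[] [] -[]|rewrite card_sum card_unit card_ord].
  rewrite -(sum_ffun_unit (fun i => \sum_l pk (x i) (x l))).
  under eq_bigr do rewrite -(sum_ffun_unit (fun l => pk (x _) (x l))).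
  rewrite -(sum_ffun_split (fun a b => pk (x (a tt)) (x (b tt))) bh).
  by apply: eq_bigr => i _; rewrite !ffunE.
- rewrite -exprM mulnC; congr (_ * _).
  pose h (u : 'I_d + 'I_d) : 'I_(2 * d) :=
    match u with inl j => pair_index j false | inr j => pair_index j true end.
  have bh : bijective h.
    apply: inj_card_bij; last by rewrite card_sum !card_ord mul2n addnn.
    move=> [] i [] j /(congr1 val)/= /eqP; rewrite ?eqn_add2r ?eqn_pmul2l//.
    + by move=> /eqP/val_inj ->.
    + by move=> /eqP /(congr1 odd); rewrite !mul2n ?addn0 ?addn1/= ?odd_double.
    + by move=> /eqP /(congr1 odd); rewrite !mul2n ?addn0 ?addn1/= ?odd_double.
    + by move=> /eqP/val_inj ->.
  rewrite -(sum_ffun_split (fun a b => pk (pick a x) (pick b x)) bh).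
  by apply: eq_bigr => i _; rewrite /term2; congr (pk _ _);
    apply: functional_extensionality_dep => j; rewrite /pick ffunE.
- rewrite -mulrA -exprS; congr (_ * (_ * _)).
  pose h (u : unit + 'I_d) : 'I_d.+1 :=
    match u with inl _ => ord0 | inr j => lift ord0 j end.
  have bh : bijective h.
    apply: inj_card_bij; last by rewrite card_sum card_unit !card_ord add1n.
    by move=> [[]|i] [[]|j]//= /lift_inj ->.
  rewrite -(sum_ffun_unit (fun i =>
    \sum_(b : {ffun 'I_d -> 'I_n}) pk (x i) (pick b x))).
  rewrite -(sum_ffun_split (fun (a : {ffun unit -> 'I_n}) b =>
    pk (x (a tt)) (pick b x)) bh).
  apply: eq_bigr => i _; rewrite /term3 ffunE; congr (pk _ _).
  by apply: functional_extensionality_dep => j; rewrite /pick ffunE.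
Qed.

Variable K : R.
Hypothesis pk_bounds : forall y z : space, 0 <= pk y z <= K.

Lemma U_V_approx x : (2 * d <= n)%N -> (2 <= d)%N ->
  `|U_dHSIC k x - V_dHSIC x| <= UV_const d K / n%:R.
Proof.
move=> dn d2; have [n0 n2 dn1] := sample_size_bounds d2 dn.
have := @inj_avg_approx R n 2 (term1 x) K _ n0 (fun i => pk_bounds _ _).
have := @inj_avg_approx R n (2 * d) (term2 x) K dn n0 (fun i => pk_bounds _ _).
have := @inj_avg_approx R n d.+1 (term3 x) K _ n0 (fun i => pk_bounds _ _).
rewrite U_dHSICE V_dHSICE => h3 h2 h1.
have {}h1 := h1 n2; have {}h3 := h3 dn1.
have -> : UV_const d K / n%:R = K * (2 ^+ 2 / n%:R) +
    K * ((2 * d)%:R ^+ 2 / n%:R) + 2 * (K * (d.+1%:R ^+ 2 / n%:R)).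
  by rewrite /UV_const; field; rewrite pnatr_eq0 -lt0n.
move: h1 h2 h3; rewrite !ler_norml => /andP[? ?] /andP[? ?] /andP[? ?].
by apply/andP; split; lra.
Qed.

End statistics.

(** * The mean of the U-statistic *)

Section mean_of_U.
Context {R : realType} {d : nat} {X : 'I_d -> diffSpace}.
Variables (k : forall j, X j -> X j -> R) (K : R).
Local Notation space := (prodspace X).
Local Notation pk := (prod_kernel k).
Hypothesis pk_bmeas : bmeas (fun z : space * space => pk z.1 z.2).
Hypothesis pk_bounds : forall y z : space, 0 <= pk y z <= K.
Hypothesis pkC : forall y z : space, pk y z = pk z y.
Implicit Types P Q M N : probability space R.

Definition kernel_mean P Q : R := \int[(P \x Q)%E]_z pk z.1 z.2.

Lemma kernel_mean_fubini P Q :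
  [/\ forall x, bmeas (fun y => pk x y), bmeas (fun x => \int[Q]_y pk x y) &
      kernel_mean P Q = \int[P]_x \int[Q]_y pk x y].
Proof.
apply: (mean_fubini P Q pk_bmeas) => z; by case/andP: (pk_bounds z.1 z.2).
Qed.

Lemma kernel_meanC P Q : kernel_mean P Q = kernel_mean Q P.
Proof.
have [_ _ ->] := kernel_mean_fubini P Q.
have [|_ /= swapE] := mean_fubini_swap Q P pk_bmeas.
  by move=> z; case/andP: (pk_bounds z.1 z.2).
rewrite [RHS]swapE.
by apply: eq_Rintegral => x _; apply: eq_Rintegral => y _ /=; exact: pkC.
Qed.

Lemma kernel_mean_bounds P Q : 0 <= kernel_mean P Q <= K.
Proof.
rewrite Rintegral_ge0/=; last by move=> z _; case/andP: (pk_bounds z.1 z.2).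
rewrite -[leRHS](mean_cst (P \x Q)%E); apply: le_Rintegral => //.
- exact: bmeas_integrable.
- by apply: bmeas_integrable; exact: bmeas_cst.
- by move=> z _; case/andP: (pk_bounds z.1 z.2).
Qed.

Lemma kernel_mean_mixture P N M Q (w : R) : 0 <= w <= 1 ->
  (forall A, measurable A -> M A = (w%:E * P A + (1 - w)%:E * N A)%E) ->
  kernel_mean M Q = w * kernel_mean P Q + (1 - w) * kernel_mean N Q.
Proof.
move=> w01 ME; have [_ bm ->] := kernel_mean_fubini M Q.
have [_ _ ->] := kernel_mean_fubini P Q; have [_ _ ->] := kernel_mean_fubini N Q.
exact: mean_mixture.
Qed.

Lemma kernel_mean_eq M N Q : (forall A, measurable A -> M A = N A) ->
  kernel_mean M Q = kernel_mean N Q.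
Proof.
move=> MN; have [_ _ ->] := kernel_mean_fubini M Q.
by have [_ _ ->] := kernel_mean_fubini N Q; exact: eq_measure_mean.
Qed.

Lemma bmeas_pick2 n (a b : 'I_d -> 'I_n) :
  bmeas (fun t : n.-tuple space => pk (pick a (tnth t)) (pick b (tnth t))).
Proof. exact: (bmeas_comp (measurable_pick2 a b) pk_bmeas). Qed.

Lemma mean_inj_avg Q n m (h : n.-tuple space -> {ffun 'I_m -> 'I_n} -> R) (c : R) :
  (m <= n)%N -> (forall i, bmeas (h^~ i)) ->
  (forall i : {ffun 'I_m -> 'I_n}, injectiveb i -> \int[iid Q n]_t h t i = c) ->
  bmeas (fun t => inj_avg (h t)) /\ \int[iid Q n]_t inj_avg (h t) = c.
Proof.
move=> mn bh hc; have bs : bmeas (fun t => \sum_(i : {ffun 'I_m -> 'I_n} |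
    injectiveb i) h t i) by apply: bmeas_sum.
split; first exact: bmeasZ.
rewrite /inj_avg meanZ// mean_sum//.
exact: (inj_avg_cst mn hc).
Qed.

(** [U_dHSIC] is unbiased for the squared RKHS distance between the law of the
    data and the product of its marginals. *)
Lemma mean_U_dHSIC Q n : (2 <= d)%N -> (2 * d <= n)%N ->
  let Q' := prod_marginals Q in
  bmeas (fun t : n.-tuple space => U_dHSIC k (tnth t)) /\
  \int[iid Q n]_t U_dHSIC k (tnth t) =
    kernel_mean Q Q + kernel_mean Q' Q' - 2 * kernel_mean Q Q'.
Proof.
move=> d2 dn Q'; have [n0 n2 dn1] := sample_size_bounds d2 dn.
have cst_law i : pick_law Q (fun _ : 'I_d => i : 'I_n) Q by left; exists i.
have [| |b1 e1] := @mean_inj_avg Q n 2 (fun t => term1 k (tnth t))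
    (kernel_mean Q Q) n2.
- by move=> i; exact: (bmeas_pick2 (fun=> i ord0) (fun=> i ord_max)).
- move=> i /injectiveP ii.
  apply: (mean_pick2 (cst_law (i ord0)) (cst_law (i ord_max)) _ pk_bmeas).
  by move=> _ _; apply/eqP => /ii.
have [| |b2 e2] := @mean_inj_avg Q n (2 * d) (fun t => term2 k (tnth t))
    (kernel_mean Q' Q') dn.
- by move=> i; exact: bmeas_pick2.
- move=> i /injectiveP ii.
  have inj_law b : pick_law Q (fun j => i (pair_index j b)) Q'.
    right; split=> // j l /ii /(congr1 val)/= /eqP.
    by rewrite eqn_add2r eqn_pmul2l// => /eqP/val_inj.
  apply: (mean_pick2 (inj_law false) (inj_law true) _ pk_bmeas).
  move=> j l; apply/eqP => /ii /(congr1 val)/= /(congr1 odd).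
  by rewrite !mul2n addn0 addn1/= !odd_double.
have [| |b3 e3] := @mean_inj_avg Q n d.+1 (fun t => term3 k (tnth t))
    (kernel_mean Q Q') dn1.
- by move=> i; exact: (bmeas_pick2 (fun=> i ord0)).
- move=> i /injectiveP ii.
  have inj_law : pick_law Q (fun j => i (lift ord0 j)) Q'.
    by right; split=> // j l /ii /lift_inj.
  apply: (mean_pick2 (cst_law (i ord0)) inj_law _ pk_bmeas).
  by move=> _ j; apply/eqP => /ii.
have UE : (fun t : n.-tuple space => U_dHSIC k (tnth t)) = fun t =>
    (inj_avg (term1 k (tnth t)) + inj_avg (term2 k (tnth t)))
    + (-2) * inj_avg (term3 k (tnth t)).
  by apply/funext => t; rewrite U_dHSICE mulNr.
rewrite UE; have b12 := bmeasD b1 b2; have b3' := bmeasZ (-2) b3.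
split; first exact: bmeasD.
by rewrite !meanD// (meanZ _ (-2))// e1 e2 e3 mulNr.
Qed.

(** The first-order terms in [w] cancel, because [Q] and the product of its
    marginals differ by [w] times a signed measure independent of [w]. *)
Lemma mean_U_mixture P Q n (w : R) : (2 <= d)%N -> (2 * d <= n)%N ->
  0 <= w <= 1 ->
  (forall A, measurable A ->
    Q A = (w%:E * P A + (1 - w)%:E * prod_marginals P A)%E) ->
  \int[iid Q n]_t U_dHSIC k (tnth t) <= 2 * K * w ^+ 2.
Proof.
move=> d2 dn w01 QE; have [_ ->] := mean_U_dHSIC Q d2 dn.
set P' := prod_marginals P.
have Q'E := prod_marginals_mixture w01 QE.
have e1 N : kernel_mean Q N = w * kernel_mean P N + (1 - w) * kernel_mean P' N.
  exact: kernel_mean_mixture w01 QE.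
have e2 N : kernel_mean (prod_marginals Q) N = kernel_mean P' N.
  exact: kernel_mean_eq.
have /andP[a0 aK] := kernel_mean_bounds P P.
have /andP[b0 bK] := kernel_mean_bounds P' P.
have /andP[c0 cK] := kernel_mean_bounds P' P'.
have PQ : kernel_mean P Q = w * kernel_mean P P + (1 - w) * kernel_mean P' P.
  by rewrite kernel_meanC e1.
have P'Q : kernel_mean P' Q = w * kernel_mean P' P + (1 - w) * kernel_mean P' P'.
  by rewrite kernel_meanC e1 (kernel_meanC P).
have -> : kernel_mean (prod_marginals Q) (prod_marginals Q) = kernel_mean P' P'.
  by rewrite e2 kernel_meanC e2.
rewrite (kernel_meanC Q (prod_marginals Q)) e2 P'Q e1 PQ P'Q.
move: a0 aK b0 bK c0 cK; set a := kernel_mean P P; set b := kernel_mean P' P.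
set c := kernel_mean P' P' => a0 aK b0 bK c0 cK.
apply: (@le_trans _ _ (w ^+ 2 * (a + c - 2 * b))).
  by rewrite le_eqVlt; apply/orP; left; apply/eqP; ring.
by rewrite [leRHS]mulrC ler_wpM2l ?sqr_ge0//; lra.
Qed.

Hypothesis V_ge0 : forall n (x : 'I_n -> space), 0 <= V_dHSIC k x.

(** The V-statistic is nonnegative on every sample, permuted or not. *)
Lemma U_dHSIC_lower n (x : 'I_n -> space) : (2 <= d)%N -> (2 * d <= n)%N ->
  - (UV_const d K / n%:R) <= U_dHSIC k x.
Proof.
move=> d2 dn; have := U_V_approx pk_bounds x dn d2; have := V_ge0 x.
by rewrite ler_norml => V0 /andP[]; lra.
Qed.

Lemma U_dHSIC_markov P Q n (w s : R) : (2 <= d)%N -> (2 * d <= n)%N ->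
  0 <= w <= 1 ->
  (forall A, measurable A ->
    Q A = (w%:E * P A + (1 - w)%:E * prod_marginals P A)%E) -> 0 < s ->
  measurable [set t : n.-tuple space |
    s <= U_dHSIC k (tnth t) + UV_const d K / n%:R] /\
  (iid Q n [set t | (s <= U_dHSIC k (tnth t) + UV_const d K / n%:R)%R] <=
    (s^-1 * (2 * K * w ^+ 2 + UV_const d K / n%:R))%:E)%E.
Proof.
move=> d2 dn w01 QE s0; have [bU _] := mean_U_dHSIC Q d2 dn.
have bW := bmeasD bU (bmeas_cst (UV_const d K / n%:R)).
split; first by apply: measurable_ler_set => //; exact: bW.1.
apply: le_trans (mean_markov (iid Q n) bW _ s0) _.
  by move=> t; have := U_dHSIC_lower (tnth t) d2 dn; lra.
rewrite lee_fin ler_wpM2l ?invr_ge0 ?(ltW s0)// meanD//; last exact: bmeas_cst.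
by rewrite mean_cst lerD2r; exact: mean_U_mixture QE.
Qed.

End mean_of_U.

(** * A lower bound for the sensitivity *)

Section sensitivity_bound.
Context {R : realType} {d : nat} {X : 'I_d -> diffSpace}.
Variables (k : forall j, X j -> X j -> R) (Kj : 'I_d -> R).
Local Notation space := (prodspace X).
Local Notation pk := (prod_kernel k).
Local Notation K := (\prod_(j < d) Kj j).
Hypothesis d_ge2 : (2 <= d)%N.
Hypothesis Kj_gt0 : forall j, 0 < Kj j.
Hypothesis k_diag : forall j (x : X j), k x x = Kj j.
Hypothesis k_bounded : forall j (x y : X j), 0 <= k x y <= Kj j.
Hypothesis k_level_sets : forall j (e : R), 0 < e < Kj j ->
  exists x x' : X j, k x x' <= e.
Variable H : rkhs (prod_kernel k).

Let K_gt0 : 0 < K. Proof. by apply: prodr_gt0 => j _; exact: Kj_gt0. Qed.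

Let pk_bounds (y z : space) : 0 <= pk y z <= K.
Proof. by rewrite (pk_ge0 k_bounded)/= (pk_le k_bounded). Qed.

Lemma inj_avg_bounds n m (h : {ffun 'I_m -> 'I_n} -> R) (M : R) : (m <= n)%N ->
  (forall i, 0 <= h i <= M) -> 0 <= inj_avg h <= M.
Proof.
move=> mn hM; have Ni0 : 0 < (n ^_ m)%:R :> R by rewrite ltr0n ffact_gt0.
rewrite inj_avgE// divr_ge0 ?(ltW Ni0)//=; last first.
  by apply: sumr_ge0 => i _; case/andP: (hM i).
rewrite ler_pdivrMr// -card_injective_ffun big_distrr/=; apply: ler_sum => i _.
by rewrite mulr1; case/andP: (hM i).
Qed.

Lemma U_dHSIC_bounded n (x : 'I_n -> space) : (2 * d <= n)%N ->
  `|U_dHSIC k x| <= 2 * K.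
Proof.
move=> dn; have [_ dn2 dn1] := sample_size_bounds d_ge2 dn.
rewrite U_dHSICE.
have /andP[? ?] := inj_avg_bounds (h := term1 k x) dn2 (fun i => pk_bounds _ _).
have /andP[? ?] := inj_avg_bounds (h := term2 k x) dn (fun i => pk_bounds _ _).
have /andP[? ?] := inj_avg_bounds (h := term3 k x) dn1 (fun i => pk_bounds _ _).
by rewrite ler_norml; apply/andP; split; lra.
Qed.

Lemma sensitivity_ge n (x y : 'I_n -> space) : (2 * d <= n)%N ->
  neighbours x y -> `|U_dHSIC k x - U_dHSIC k y| <= sensitivity k n.
Proof.
move=> dn xy; apply: ub_le_sup.
  exists (4 * K) => _ [pi [x' [y' [_ ->]]]].
  apply: le_trans (ler_normB _ _) _.
  have := U_dHSIC_bounded (permute pi x') dn.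
  by have := U_dHSIC_bounded (permute pi y') dn; lra.
have permute1 z : permute (@id_perm d n) z = z :> ('I_n -> space).
  apply/funext => i; apply: functional_extensionality_dep => j.
  by rewrite /permute ffunE perm1.
by exists (@id_perm d n), x, y; split=> //; rewrite !permute1.
Qed.

(** The samples interpolating between all observations at [q] and all at [p]. *)
Definition step_data (p q : space) n (m : nat) : 'I_n -> space :=
  fun i => if (i < m)%N then p else q.
Arguments step_data : clear implicits.

Lemma U_dHSIC_constant n (q : space) : (2 * d <= n)%N ->
  U_dHSIC k (fun _ : 'I_n => q) = 0.
Proof.
move=> dn; have [_ dn2 dn1] := sample_size_bounds d_ge2 dn.
rewrite U_dHSICE !(inj_avg_cst (c := pk q q))//; lra.
Qed.

(** A change of the whole sample is a chain of at most [n] single changes. *)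
Lemma U_step_data_le (p q : space) n m : (2 * d <= n)%N -> (m <= n)%N ->
  U_dHSIC k (step_data p q n m) <= m%:R * sensitivity k n.
Proof.
move=> dn; elim: m => [_|m IH mn].
  rewrite mul0r (_ : step_data p q n 0 = fun=> q) ?U_dHSIC_constant//.
rewrite -natr1 mulrDl mul1r.
have nb : neighbours (step_data p q n m.+1) (step_data p q n m).
  exists (Ordinal mn) => i; rewrite -val_eqE/= => im.
  by rewrite /step_data ltnS leq_eqVlt (negPf im).
have := sensitivity_ge dn nb; rewrite ler_norml => /andP[_].
by have := IH (ltnW mn); lra.
Qed.

Lemma sum_step n m (a b : R) : (m <= n)%N ->
  \sum_(i < n) (if (i < m)%N then a else b) = m%:R * a + (n - m)%:R * b.
Proof.
move=> mn; rewrite -(big_mkord xpredT (fun i => if (i < m)%N then a else b)).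
rewrite (big_cat_nat (leq0n m) mn)/= (eq_big_nat _ _ (F2 := fun=> a)); last first.
  by move=> i /andP[_ ->].
rewrite [X in _ + X](eq_big_nat _ _ (F2 := fun=> b)); last first.
  by move=> i /andP[mi _]; rewrite ltnNge mi.
by rewrite !sumr_const_nat subn0 !mulr_natl.
Qed.

(** Half of the observations at [p], half at [q], nearly orthogonal in each
    coordinate: the coordinates are dependent. Tested against [pk p], the two
    embeddings differ, as the joint law charges [p] with weight about [1/2] and
    the product of the marginals only with [(1/2) ^ d]. *)
Lemma V_half_data (p q : space) n : (2 <= n)%N ->
  (forall j, k (p j) (q j) <= Kj j / 10) ->
  K * (3 / 100) ^+ 2 <= V_dHSIC k (step_data p q n n./2).
Proof.
move=> n2 pq; set x := step_data p q n n./2.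
have n0 : (0 < n)%N by exact: ltnW.
have nR : 0 < n%:R :> R by rewrite ltr0n.
have hn : (n./2 <= n)%N by rewrite leq_half_double leqW// -addnn leq_addr.
pose th : R := n./2%:R / n%:R.
have th2 : th <= 1 / 2.
  rewrite ler_pdivrMr// mulrC mul1r ler_pdivlMr// -natrM ler_nat.
  by rewrite muln2 -[leqRHS](odd_double_half n) leq_addl.
have th3 : 1 / 3 <= th.
  rewrite ler_pdivlMr// mulrC mul1r ler_pdivrMr// -natrM ler_nat.
  have h0 : (0 < n./2)%N by rewrite half_gt0.
  rewrite -{1}(odd_double_half n) mulnSr muln2 addnC leq_add2l.
  by case: (odd n).
have [_ /(_ (pk p) (rkhs_kernel H p))] := embedding_gap_ge0 H n%:R^-1 (n%:R^-1 ^+ d) x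
    (fun a : {ffun 'I_d -> 'I_n} => pick a x).
rewrite rkhs_kernel_ip (pk_diag k_diag) => VB.
have S1 : th * K <= n%:R^-1 * \sum_i pk p (x i).
  have -> : th * K = n%:R^-1 * (n./2%:R * K) by rewrite /th; ring.
  rewrite ler_wpM2l ?invr_ge0 ?(ltW nR)//.
  rewrite (_ : _ * K = \sum_(i < n) (if (i < n./2)%N then K else 0)); last first.
    by rewrite sum_step// mulr0 addr0.
  apply: ler_sum => i _; rewrite /x /step_data; case: ifP => _.
    by rewrite (pk_diag k_diag).
  by case/andP: (pk_bounds p q).
have S2 : n%:R^-1 ^+ d * \sum_(a : {ffun 'I_d -> 'I_n}) pk p (pick a x) <=
    K * (121 / 400).
  rewrite /prod_kernel /pick.
  rewrite -(bigA_distr_bigA (fun j i => k (p j) (x i j))).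
  rewrite -[X in _ ^+ X]card_ord -prodr_const -big_split/=.
  (* [th + (1 - th) / 10 <= u], and [u ^ 2 = 121/400] leaves [1/3 - u ^ 2 > 3/100] *)
  pose u : R := 11 / 20.
  apply: (@le_trans _ _ (\prod_(j < d) (Kj j * u))).
    apply: ler_prod => j _; rewrite mulr_ge0 ?invr_ge0 ?(ltW nR)//=; last first.
      by apply: sumr_ge0 => i _; case/andP: (k_bounded (p j) (x i j)).
    apply: (@le_trans _ _ (n%:R^-1 *
        \sum_(i < n) (if (i < n./2)%N then Kj j else Kj j / 10))).
      rewrite ler_wpM2l ?invr_ge0 ?(ltW nR)//; apply: ler_sum => i _.
      by rewrite /x /step_data; case: ifP => _; [rewrite k_diag | exact: pq].
    rewrite sum_step// natrB//.
    have -> : n%:R^-1 * (n./2%:R * Kj j + (n%:R - n./2%:R) * (Kj j / 10)) =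
        Kj j * (th + (1 - th) / 10) by rewrite /th; field; rewrite gt_eqF.
    by rewrite ler_wpM2l ?(ltW (Kj_gt0 j))// /u; lra.
  rewrite big_split/= prodr_const card_ord ler_wpM2l ?(ltW K_gt0)//.
  have -> : 121 / 400 = u ^+ 2 by rewrite /u; field.
  by apply: ler_wiXn2l => //; rewrite /u; lra.
have dK : 3 / 100 * K <= n%:R^-1 * \sum_i pk p (x i) -
    n%:R^-1 ^+ d * \sum_(a : {ffun 'I_d -> 'I_n}) pk p (pick a x).
  have h3 : 1 / 3 * K <= th * K by rewrite ler_wpM2r ?(ltW K_gt0).
  by have := K_gt0; lra.
rewrite -(ler_pM2l K_gt0); apply: le_trans VB.
rewrite mulrA -expr2 -exprMn [K * _]mulrC.
by apply: lerXn2r => //; rewrite nnegrE; have := K_gt0; lra.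
Qed.

(** [U_dHSIC] vanishes on a constant sample and stays away from [0] on the half
    and half sample; one of the at most [n] single changes between the two must
    account for a fraction [1/n] of the difference. *)
Lemma sensitivity_lower_levels (p q : space) :
  (forall j, k (p j) (q j) <= Kj j / 10) ->
  \forall n \near \oo, K * ((3 / 100) ^+ 2 / 2) / n%:R <= sensitivity k n.
Proof.
move=> pq; set e := (3 / 100) ^+ 2.
have e0 : 0 < e by rewrite exprn_gt0// divr_gt0.
have Ke : 0 < K * (e / 2) by rewrite mulr_gt0// divr_gt0.
pose C := UV_const d K.
near=> n.
have dn : (2 * d <= n)%N by near: n; exact: nbhs_infty_ge.
have [_ n2 _] := sample_size_bounds d_ge2 dn.
have nR : 0 < n%:R :> R by rewrite ltr0n ltnW.
have Cn : C / n%:R <= K * (e / 2).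
  rewrite ler_pdivrMr// mulrC -ler_pdivrMr//.
  by near: n; exact: nbhs_infty_ger.
have hn : (n./2 <= n)%N by rewrite leq_half_double leqW// -addnn leq_addr.
have := U_step_data_le p q dn hn.
have := V_half_data n2 pq; rewrite -/e.
have := U_V_approx pk_bounds (step_data p q n n./2) dn d_ge2.
rewrite ler_norml -/C => /andP[h1 h2] h3 h4.
rewrite ler_pdivrMr// [leRHS]mulrC.
apply: (@le_trans _ _ (n./2%:R * sensitivity k n)); first by lra.
rewrite ler_wpM2r ?ler_nat//.
apply: le_trans (sensitivity_ge dn (_ : neighbours (fun=> p) (fun=> p))) => //.
by exists (Ordinal (ltnW n2)).
Unshelve. all: by end_near.
Qed.

Lemma sensitivity_lower : exists2 c : R, 0 < c &
  \forall n \near \oo, c / n%:R <= sensitivity k n.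
Proof.
have lev j : exists z : X j * X j, k z.1 z.2 <= Kj j / 10.
  have [|p [q pq]] := @k_level_sets j (Kj j / 10); last by exists (p, q).
  by have := Kj_gt0 j; lra.
exists (K * ((3 / 100) ^+ 2 / 2)).
  by rewrite mulr_gt0// divr_gt0// exprn_gt0// divr_gt0.
apply: (@sensitivity_lower_levels (fun j => (projT1 (cid (lev j))).1)
                                  (fun j => (projT1 (cid (lev j))).2)).
by move=> j; exact: projT2 (cid (lev j)).
Qed.

End sensitivity_bound.

(** * Rates in the high-privacy regime *)

Section rates.
Context {R : realType}.
Implicit Types (r e : R) (n : nat).

(** Every rate of the proof is expressed with this small quantity [v]: the product
    [n * xi] is of order [v ^- 4], the logarithm is [O(v^-1)], hence the radius is
    [O(v ^+ 3)], and [1/n <= v ^+ 8]. *)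
Definition rate r n : R := n%:R `^ (- ((1 / 2 - r) / 4)).

Lemma rate_bounds r n : 0 < r < 1 / 2 -> (0 < n)%N -> 0 < rate r n <= 1.
Proof.
move=> /andP[r0 r1] n0; rewrite /rate powR_gt0 ?ltr0n//=.
rewrite -[leRHS](powRr0 n%:R) ler_powR ?ler1n//; lra.
Qed.

Lemma rate_small r e : 0 < r < 1 / 2 -> 0 < e ->
  \forall n \near \oo, rate r n <= e.
Proof.
move=> /andP[r0 r1] e0; set g := (1 / 2 - r) / 4.
have g0 : 0 < g by rewrite /g; lra.
near=> n.
have nR : 0 < n%:R :> R by rewrite ltr0n; near: n; exact: nbhs_infty_gt.
rewrite /rate -/g powRN invf_ple ?posrE ?powR_gt0//.
have -> : e^-1 = (e^-1 `^ g^-1) `^ g.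
  by rewrite -powRrM mulVf ?gt_eqF// powRr1// invr_ge0 ltW.
rewrite ge0_ler_powR ?nnegrE ?powR_ge0 ?(ltW g0) ?(ltW nR)//.
by near: n; exact: nbhs_infty_ger.
Unshelve. all: by end_near.
Qed.

Lemma rate_pow4 r n : rate r n ^+ 4 = n%:R `^ (- (1 / 2 - r)).
Proof.
rewrite -powR_mulrn ?powR_ge0// -powRrM; congr (_ `^ _).
by field.
Qed.

Lemma powR_noise r n : (0 < n)%N ->
  n%:R * n%:R `^ (- (1 / 2) - r) = rate r n ^- 4 :> R.
Proof.
move=> n0; rewrite rate_pow4 -powRN.
rewrite -{1}(@powRr1 _ n%:R)// -powRD; last by rewrite pnatr_eq0 -lt0n n0 implybT.
by congr (_ `^ _); field.
Qed.

Lemma invn_sqrt_rate r n : 0 < r < 1 / 2 -> (0 < n)%N ->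
  Num.sqrt n%:R^-1 <= rate r n ^+ 4 /\ n%:R^-1 <= rate r n ^+ 8.
Proof.
move=> /andP[r0 r1] n0; have h : Num.sqrt n%:R^-1 <= rate r n ^+ 4.
  rewrite sqrtrV// -powR12_sqrt// -powRN rate_pow4.
  by rewrite ler_powR ?ler1n//; lra.
split=> //; rewrite -[leLHS]sqr_sqrtr ?invr_ge0// (exprM _ 4 2).
by rewrite lerXn2r// nnegrE ?sqrtr_ge0// exprn_ge0// powR_ge0.
Qed.

Lemma ln_le_rate r n : 0 < r < 1 / 2 -> (0 < n)%N ->
  ln n%:R <= 4 / (1 / 2 - r) * (rate r n)^-1.
Proof.
move=> /andP[r0 r1] n0; set g := 1 / 2 - r; have g0 : 0 < g by rewrite /g; lra.
rewrite /rate -/g powRN invrK.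
have := ln_sublinear (powR_gt0 (g / 4) (_ : 0 < n%:R :> R)).
rewrite ltr0n n0 => /(_ isT)/ltW; rewrite ln_powR => h.
rewrite -(ler_pM2l (_ : 0 < g / 4)); last by lra.
apply: le_trans h _; rewrite mulrA.
by have -> : g / 4 * (4 / g) = 1 :> R; [field; rewrite gt_eqF | rewrite mul1r].
Qed.

Lemma divD1_le1 (x : R) : 0 <= x -> x / (x + 1) <= 1.
Proof. by move=> x0; rewrite ler_pdivrMr ?mul1r; lra. Qed.

(** The mixture weight [w] tends to [0], and the mean of the statistic, of order
    [w ^ 2 + 1/n], is negligible compared with the noise level
    [2 * sens n / xi n]. *)
Lemma high_privacy_rates r (xi sens : nat -> R) (L rho0 K C c s : R) :
  0 < r < 1 / 2 -> 0 <= L -> 0 < rho0 -> 0 <= K -> 0 <= C -> 0 < c -> 0 < s ->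
  same_order xi (fun n => n%:R `^ (- (1 / 2) - r)) ->
  (\forall n \near \oo, c / n%:R <= sens n) ->
  let rho n := ln n%:R * Num.max (Num.sqrt (L / n%:R)) (L / (n%:R * xi n)) in
  \forall n \near \oo, let w := 2 * rho n / rho0 in
    [/\ 0 < xi n, 0 < sens n, 0 <= w <= 1 &
      (2 * sens n * (xi n)^-1 * s)^-1 * (2 * K * w ^+ 2 + C / n%:R) <= s].
Proof.
move=> r01 L0 rho00 K0 C0 c0 s0 [c1 [C1 [c10 C10 xiE]]] sensE rho.
have g0 : 0 < 1 / 2 - r by move/andP: r01 => [? ?]; lra.
pose M := Num.sqrt L + L / c1.
have M0 : 0 <= M by rewrite addr_ge0 ?sqrtr_ge0// divr_ge0// ltW.
pose W := 2 * (4 / (1 / 2 - r) * M) / rho0.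
have W0 : 0 <= W.
  by rewrite divr_ge0 ?(ltW rho00)// mulr_ge0// mulr_ge0// divr_ge0// ltW.
pose D := C1 / (2 * c * s) * (2 * K * W ^+ 2 + C).
have D0 : 0 <= D.
  rewrite mulr_ge0//; last by rewrite addr_ge0// mulr_ge0 ?sqr_ge0// mulr_ge0.
  by rewrite divr_ge0 ?ltW// !mulr_gt0.
near=> n; set w := 2 * rho n / rho0.
have n0 : (0 < n)%N by near: n; exact: nbhs_infty_gt.
have nR : 0 < n%:R :> R by rewrite ltr0n.
have /andP[v0 v1] := rate_bounds r01 n0; set v := rate r n in v0 v1.
have vW : v <= (W + 1)^-1.
  by rewrite /v; near: n; apply: rate_small => //; rewrite invr_gt0; lra.
have vD : v <= s / (D + 1).
  by rewrite /v; near: n; apply: rate_small => //; rewrite divr_gt0//; lra.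
have sn : c / n%:R <= sens n by near: n.
have /andP[xl xu] : c1 <= xi n / n%:R `^ (- (1 / 2) - r) <= C1 by near: n.
have p0 : 0 < n%:R `^ (- (1 / 2) - r) :> R by rewrite powR_gt0.
have nx : n%:R * n%:R `^ (- (1 / 2) - r) = v ^- 4 by exact: powR_noise.
move: xl xu; rewrite ler_pdivlMr// ler_pdivrMr// => xl xu.
have xi0 : 0 < xi n by apply: lt_le_trans xl; rewrite mulr_gt0.
have sens0 : 0 < sens n by apply: lt_le_trans sn; rewrite divr_gt0.
have nxl : c1 * v ^- 4 <= n%:R * xi n.
  by rewrite -nx mulrCA ler_wpM2l// ltW.
have nxu : n%:R * xi n <= C1 * v ^- 4.
  by rewrite -nx mulrCA ler_wpM2l// ltW.
have [sq iv] := invn_sqrt_rate r01 n0; rewrite -/v in sq iv.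
have v4 : 0 < v ^+ 4 by rewrite exprn_gt0.
have max_le : Num.max (Num.sqrt (L / n%:R)) (L / (n%:R * xi n)) <= M * v ^+ 4.
  rewrite ge_max; apply/andP; split.
    rewrite sqrtrM// (le_trans (ler_wpM2l (sqrtr_ge0 _) sq))//.
    by rewrite ler_wpM2r ?(ltW v4)// /M lerDl divr_ge0// ltW.
  apply: (@le_trans _ _ (L / c1 * v ^+ 4)); last first.
    by rewrite ler_wpM2r ?(ltW v4)// /M lerDr sqrtr_ge0.
  have cv : c1^-1 * v ^+ 4 = (c1 * v ^- 4)^-1 by rewrite invfM invrK.
  by rewrite -mulrA cv ler_wpM2l// lef_pV2 ?posrE ?mulr_gt0 ?invr_gt0.
have max_ge : 0 <= Num.max (Num.sqrt (L / n%:R)) (L / (n%:R * xi n)).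
  by rewrite le_max sqrtr_ge0.
have ln0 : 0 <= ln n%:R :> R by rewrite ln_ge0// ler1n.
have rho_le : rho n <= 4 / (1 / 2 - r) * M * v ^+ 3.
  apply: le_trans (ler_pM ln0 max_ge (ln_le_rate r01 n0) max_le) _.
  rewrite le_eqVlt; apply/orP; left; apply/eqP; rewrite -/v.
  by move: (4 / (1 / 2 - r)) => q; field; rewrite gt_eqF.
have rho_ge : 0 <= rho n by rewrite mulr_ge0.
have w0 : 0 <= w by rewrite divr_ge0 ?(ltW rho00)// mulr_ge0.
have wW : w <= W * v ^+ 3.
  rewrite /w /W [leRHS]mulrAC ler_wpM2r ?invr_ge0 ?(ltW rho00)//.
  by rewrite -[leRHS]mulrA ler_wpM2l.
split=> //.
  rewrite w0/=; apply: le_trans wW _; apply: (@le_trans _ _ (W * v)).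
    by rewrite ler_wpM2l// exprS ler_piMr ?(ltW v0)// exprn_ile1// ltW.
  apply: (@le_trans _ _ (W * (W + 1)^-1)); first exact: ler_wpM2l.
  exact: divD1_le1.
apply: (@le_trans _ _ (D * v)); last first.
  apply: (@le_trans _ _ (D * (s / (D + 1)))); first exact: ler_wpM2l.
  by rewrite mulrCA ler_piMr ?(ltW s0)// divD1_le1.
have f1 : (2 * sens n * (xi n)^-1 * s)^-1 <= C1 / (2 * c * s) * v ^- 4.
  have -> : (2 * sens n * (xi n)^-1 * s)^-1 = xi n * (2 * s)^-1 * (sens n)^-1.
    by field; rewrite !gt_eqF.
  apply: (@le_trans _ _ (xi n * (2 * s)^-1 * (c / n%:R)^-1)).
    rewrite ler_wpM2l ?lef_pV2 ?posrE ?divr_gt0//.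
    by rewrite divr_ge0 ?ltW// mulr_gt0.
  have -> : xi n * (2 * s)^-1 * (c / n%:R)^-1 = (2 * c * s)^-1 * (n%:R * xi n).
    by field; rewrite !gt_eqF.
  rewrite [leRHS]mulrAC [leRHS]mulrC ler_wpM2l// invr_ge0 ltW// !mulr_gt0//.
have f2 : 2 * K * w ^+ 2 + C / n%:R <= (2 * K * W ^+ 2 + C) * v ^+ 6.
  rewrite [leRHS]mulrDl lerD//.
    rewrite -[leRHS]mulrA ler_wpM2l ?mulr_ge0// (exprM _ 3 2) -exprMn lerXn2r// nnegrE//.
    by rewrite mulr_ge0// exprn_ge0// ltW.
  rewrite ler_wpM2l// (le_trans iv)// (exprD _ 6 2) ler_piMr//.
    by rewrite exprn_ge0// ltW.
  by rewrite exprn_ile1// ltW.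
apply: le_trans (ler_pM _ _ f1 f2) _.
- by rewrite invr_ge0 ltW// !mulr_gt0// invr_gt0.
- by rewrite addr_ge0 ?divr_ge0// mulr_ge0 ?sqr_ge0// mulr_ge0.
have -> : C1 / (2 * c * s) * v ^- 4 * ((2 * K * W ^+ 2 + C) * v ^+ 6) =
    D * v ^+ 2 by rewrite /D; field; rewrite !gt_eqF.
by rewrite ler_wpM2l// expr2 ler_piMl// ltW.
Unshelve. all: by end_near.
Qed.

End rates.

(** * The power of the test *)

Section power_bound.
Context {R : realType} {d : nat} {X : 'I_d -> diffSpace}.
Variables (k : forall j, X j -> X j -> R) (n B : nat) (xi alpha : R).
Local Notation space := (prodspace X).

(** As no permuted statistic is below [-C], an entry of the noise exceeding entry
    [0] by [s] puts the corresponding noisy statistic above the unpermuted one. *)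
Lemma dp_test_bad (C s : R) (x : 'I_n -> space) pi (t : B.+1.-tuple R) :
  0 < xi -> 0 < sensitivity k n ->
  (forall y : 'I_n -> space, - C <= U_dHSIC k y) ->
  U_dHSIC k x + C < 2 * sensitivity k n * xi^-1 * s ->
  dp_pvalue k xi x pi (tnth t) <= alpha -> bad_noise alpha s t.
Proof.
move=> xi0 D0 UC Ux; rewrite /dp_pvalue mulrC ler_pdivrMr// => pa.
apply: bad_noiseP; apply: le_trans pa; rewrite addrC lerD2r.
apply: ler_sum => b _; rewrite ler_nat.
case: (boolP (_ + s <= _)) => // sb; rewrite (_ : _ <= _ = true)//.
have e0 : permute (oapp pi (@id_perm d n) (unlift ord0 (ord0 : 'I_B.+1))) x = x.
  rewrite unlift_none/=; apply/funext => i.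
  by apply: functional_extensionality_dep => j; rewrite /permute ffunE perm1.
rewrite /noisy_stat e0; set M := 2 * _ * _.
have M0 : 0 < M by rewrite !mulr_gt0// invr_gt0.
have := UC (permute (oapp pi (@id_perm d n) (unlift ord0 (lift ord0 b))) x).
have : M * (tnth t ord0 + s) <= M * tnth t (lift ord0 b) by rewrite ler_pM2l.
by rewrite mulrDr -/M; move: Ux; rewrite -/M; lra.
Qed.

(** The rejection event is covered by one event about the data and one about
    the noise, whatever the permutations. *)
Lemma dp_power_le (Q : probability space R) (p C s : R) :
  0 < xi -> 0 < sensitivity k n -> 0 <= alpha -> 0 <= s ->
  (forall y : 'I_n -> space, - C <= U_dHSIC k y) ->
  let E := [set t : n.-tuple space |
    2 * sensitivity k n * xi^-1 * s <= U_dHSIC k (tnth t) + C] in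
  measurable E -> (iid Q n E <= p%:E)%E ->
  (dp_power k n B xi alpha Q <= (p + (alpha + B%:R * s))%:E)%E.
Proof.
move=> xi0 D0 a0 s0 UC E mE pE; set q := p + _.
pose mu : probability _ R := (iid Q n \x iid (@laplace_prob R) B.+1)%E.
have [mN pN] := @bad_noise_prob R B alpha s a0 s0.
have pi_le pi : ('E_mu[(fun z => dp_test k xi alpha (tnth z.1) pi (tnth z.2))]
    <= q%:E)%E.
  rewrite unlock.
  pose A : set (n.-tuple space * B.+1.-tuple R) :=
    (E `*` setT) `|` (setT `*` bad_noise alpha s).
  have mE' : measurable (E `*` [set: B.+1.-tuple R]) by exact: measurableX.
  have mN' := measurableX (measurableT (s := n.-tuple space)) mN.
  apply: (@le_trans _ _ (mu A)).
    apply: integral_le_prob; first exact: measurableU.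
    move=> z; rewrite ler0n/= indicE ler_nat.
    case: (boolP (dp_pvalue _ _ _ _ _ <= _)) => // rej.
    rewrite mem_set//; have [Ez|nE] := pselect (E z.1); first by left.
    right; split=> //=; apply: (dp_test_bad xi0 D0 UC _ rej).
    by rewrite ltNge; apply/negP.
  have E1 : (mu (E `*` setT) = iid Q n E * iid (@laplace_prob R) B.+1 setT)%E.
    exact: product_measure1E.
  have N1 : (mu (setT `*` bad_noise alpha s) =
      iid Q n setT * iid (@laplace_prob R) B.+1 (bad_noise alpha s))%E.
    exact: product_measure1E.
  rewrite probability_setT mule1 in E1; rewrite probability_setT mul1e in N1.
  rewrite -E1 in pE; rewrite -N1 in pN.
  by apply: le_trans (measureU2 mu mE' mN') _; rewrite /q EFinD leeD.
rewrite /dp_power.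
have N0 : (0 < #|{: {ffun 'I_B -> {ffun 'I_d -> 'S_n}}}|)%N.
  by apply/card_gt0P; exists [ffun _ => @id_perm d n].
apply: (@le_trans _ _ ((#|{: {ffun 'I_B -> {ffun 'I_d -> 'S_n}}}|%:R^-1)%:E *
   \sum_(pi : {ffun 'I_B -> {ffun 'I_d -> 'S_n}}) q%:E)%E).
  rewrite lee_wpmul2l ?lee_fin ?invr_ge0//; apply: lee_sum => pi _; exact: pi_le.
rewrite sumEFin -EFinM lee_fin sumr_const -[q *+ _]mulr_natl mulrA.
by rewrite mulVf ?mul1r// pnatr_eq0 -lt0n.
Qed.

End power_bound.

Section alternatives.
Context {R : realType} {d : nat} {X : 'I_d -> diffSpace}.
Variables (k : forall j, X j -> X j -> R) (H : rkhs (prod_kernel k)).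
Local Notation space := (prodspace X).
Hypothesis H_bmeas : forall f, rkhs_set H f -> bmeas f.

Lemma expectation_gap (P Q : probability space R) f : rkhs_set H f ->
  ('E_P[f] - 'E_Q[f] = (\int[P]_x f x - \int[Q]_x f x)%:E)%E.
Proof.
by move=> Hf; rewrite !expectation_mean ?EFinB//; exact: H_bmeas.
Qed.

(** dHSIC is linear along the segment from the product of the marginals of [P]
    to [P], whose members have the same marginals. *)
Lemma dHSIC_mixture (P Q : probability space R) (w rho0 : R) :
  0 <= w <= 1 -> 0 < rho0 ->
  (forall A, measurable A ->
    Q A = (w%:E * P A + (1 - w)%:E * prod_marginals P A)%E) ->
  dHSIC H P = rho0%:E -> ((w * (rho0 / 2))%:E <= dHSIC H Q)%E.
Proof.
move=> w01 r0 QE dP.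
have : ((rho0 / 2)%:E < dHSIC H P)%E by rewrite dP lte_fin; lra.
move=> /ereal_sup_gt[_ [f [Hf f1] <-]]; rewrite expectation_gap// lte_fin => fr.
apply: (@le_trans _ _ ('E_Q[f] - 'E_(prod_marginals Q)[f])%E); last first.
  by apply: ereal_sup_ubound; exists f.
rewrite expectation_gap// lee_fin.
rewrite (eq_measure_mean _ (prod_marginals_mixture w01 QE)).
rewrite (mean_mixture w01 QE (H_bmeas Hf)).
move: w01 fr => /andP[w0 _].
set a := \int[P]_x f x; set b := \int[prod_marginals P]_x f x => fr.
have -> : w * a + (1 - w) * b - b = w * (a - b) by ring.
by rewrite ler_wpM2l// ltW.
Qed.

(** A kernel vanishing on the diagonal leaves only the zero function in the
    Hilbert space. *)
Lemma dHSIC_eq0 (P : probability space R) :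
  (forall x, prod_kernel k x x = 0) -> (dHSIC H P <= 0)%E.
Proof.
move=> k0; apply: ge_ereal_sup => _ [f [Hf _] <-].
have f0 : f = fun=> 0.
  apply/funext => x; have := rkhs_eval_le x Hf.
  by rewrite k0 mulr0 => h; apply/eqP; rewrite -sqrf_eq0 eq_le h sqr_ge0.
by rewrite expectation_gap// f0 !mean_cst subrr.
Qed.

End alternatives.

Lemma limn_esup_le {R : realType} (u : nat -> \bar R) (a b : R) : 0 <= b ->
  (forall s : R, 0 < s -> \forall n \near \oo, (u n <= (a + b * s)%:E)%E) ->
  (limn_esup u <= a%:E)%E.
Proof.
move=> b0 us; apply/lee_addgt0Pr => e e0.
have s0 : 0 < e / (b + 1) by rewrite divr_gt0//; lra.
have [N _ uN] := us _ s0.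
apply: (@le_trans _ _ (ereal_sup [set u n | n in [set n | (N <= n)%N]])).
  by apply: ereal_inf_lbound; exists [set n | (N <= n)%N] => //; exists N.
apply: ge_ereal_sup => _ [n Nn <-]; apply: le_trans (uN n Nn) _.
rewrite -EFinD lee_fin lerD2l mulrCA ler_piMr ?(ltW e0)//.
exact: divD1_le1.
Qed.

Theorem theoremC1 (R : realType) (d : nat) (d_ge2 : (2 <= d)%N)
    (X : 'I_d -> diffSpace)
    (X_separable : forall j, separable_space (X j))
    (k : forall j, X j -> X j -> R)
    (kappa : forall j, X j -> R)
    (k_continuous : forall j,
      continuous (fun z : X j * X j => k j z.1 z.2))
    (k_psd : forall j, psd_kernel (k j))
    (kappa_posdef : forall j, posdef_fun (kappa j))
    (k_translation : forall j (x x' : X j), k j x x' = kappa j (x - x'))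
    (k_bounded : forall j (x x' : X j), 0 <= k j x x' <= kappa j 0)
    (k_level_sets : forall j (e : R), 0 < e < kappa j 0 ->
      exists x x' : X j, k j x x' <= e)
    (H : rkhs (prod_kernel k))
    (k_characteristic : characteristic_kernel H)
    (Pcls : set (probability (prodspace X) R))
    (Pcls_mixture : forall P, Pcls P -> forall w : R, 0 <= w <= 1 ->
      exists2 Q, Pcls Q & forall A, measurable A ->
        Q A = (w%:E * P A + (1 - w)%:E * prod_marginals P A)%E)
    (rho0 : R) (rho0_gt0 : 0 < rho0)
    (Pcls_rho0 : exists2 P, Pcls P & dHSIC H P = rho0%:E)
    (B : nat) (alpha beta : R)
    (alpha_bounds : (B.+1)%:R^-1 < alpha < 1)
    (beta_bounds : 0 < beta < 1 - alpha)
    (eps delta : nat -> R)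
    (eps_gt0 : forall n, 0 < eps n)
    (delta_bounds : forall n, 0 <= delta n < 1)
    (r : R) (r_bounds : 0 < r < 1 / 2) :
  let xi n := privacy_xi (eps n) (delta n) in
  same_order xi (fun n => n%:R `^ (- (1 / 2) - r)) ->
  let L := Num.max (ln (1 / alpha)) (ln (1 / beta)) in
  let rho n :=
    ln n%:R * Num.max (Num.sqrt (L / n%:R)) (L / (n%:R * xi n)) in
  (limn_esup (fun n =>
     ereal_inf [set dp_power k n B (xi n) alpha P |
       P in [set P | Pcls P /\ (rho n)%:E <= dHSIC H P]])
   <= alpha%:E)%E.
Proof.
move=> xi xiE.
pose L := Num.max (ln (1 / alpha)) (ln (1 / beta)).
pose rho n :=
  ln n%:R * Num.max (Num.sqrt (L / n%:R)) (L / (n%:R * xi n)).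
change (limn_esup (fun n =>
     ereal_inf [set dp_power k n B (xi n) alpha P |
       P in [set P | Pcls P /\ ((rho n)%:E <= dHSIC H P)%E]])
   <= alpha%:E)%E.
pose Kj j := kappa j 0; pose K := \prod_(j < d) Kj j.
have k_diag j (x : X j) : k j x x = Kj j by rewrite k_translation subrr.
have kb j (x y : X j) : 0 <= k j x y <= Kj j by exact: k_bounded.
have Hb := rkhs_bmeas X_separable k_continuous k_diag kb (H := H).
have pkb := pk_bmeas X_separable k_continuous k_diag kb H.
have pk01 (y z : prodspace X) : 0 <= prod_kernel k y z <= K.
  by rewrite (pk_ge0 kb)/= (pk_le kb).
have [P clsP dP] := Pcls_rho0.
have Kj0 j : 0 < Kj j.
  rewrite lt_neqAle (Kj_ge0 kb) andbT eq_sym; apply/eqP => K0.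
  have /(dHSIC_eq0 Hb P) : forall x, prod_kernel k x x = 0.
    by move=> x; rewrite (pk_diag k_diag) (bigD1 j)//= K0 mul0r.
  by rewrite dP lee_fin leNgt rho0_gt0.
have [c c0 sensE] := sensitivity_lower d_ge2 Kj0 k_diag kb k_level_sets H.
have [a1 a2] := andP alpha_bounds.
have a0 : 0 < alpha by apply: lt_trans a1; rewrite invr_gt0.
have L0 : 0 <= L by rewrite le_max ln_ge0//= ler_pdivlMr// mul1r ltW.
have K0 : 0 <= K by exact: K_ge0 kb.
pose C := UV_const d K.
have C0 : 0 <= C by rewrite mulr_ge0// !addr_ge0// mulr_ge0.
have V0 n (x : 'I_n -> prodspace X) : 0 <= V_dHSIC k x.
  exact: (embedding_gap_ge0 H _ _ _ _).1.
apply: (@limn_esup_le _ _ alpha (B%:R + 1)); first by rewrite addr_ge0.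
move=> s s0.
have rates := high_privacy_rates r_bounds L0 rho0_gt0 K0 C0 c0 s0 xiE sensE.
near=> n.
have dn : (2 * d <= n)%N by near: n; exact: nbhs_infty_ge.
have : [/\ 0 < xi n, 0 < sensitivity k n, 0 <= 2 * rho n / rho0 <= 1 &
      (2 * sensitivity k n * (xi n)^-1 * s)^-1 *
      (2 * K * (2 * rho n / rho0) ^+ 2 + C / n%:R) <= s] by near: n.
set w := 2 * rho n / rho0; move=> [xi0 D0 w01 ms].
have [Q clsQ QE] := Pcls_mixture P clsP w w01.
apply: (@le_trans _ _ (dp_power k n B (xi n) alpha Q)).
  apply: ereal_inf_lbound; exists Q => //; split=> //.
  apply: le_trans (dHSIC_mixture Hb w01 rho0_gt0 QE dP).
  by rewrite lee_fin le_eqVlt; apply/orP; left; apply/eqP; rewrite /w; field;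
    rewrite gt_eqF.
have t0 : 0 < 2 * sensitivity k n * (xi n)^-1 * s.
  by rewrite !mulr_gt0// invr_gt0.
have [mE pE] := U_dHSIC_markov pkb pk01 (rkhs_kernelC H) V0 d_ge2 dn w01 QE t0.
have UC (y : 'I_n -> prodspace X) := U_dHSIC_lower pk01 V0 y d_ge2 dn.
apply: le_trans (dp_power_le B (p := s) xi0 D0 (ltW a0) (ltW s0) UC mE _) _.
  by apply: le_trans pE _; rewrite lee_fin.
by rewrite lee_fin; lra.
Unshelve. all: by end_near.
Qed.
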